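(* Consider the affine control system $\dot x(t)=A(u(t))x(t)+Cu(t)+d$ in $\mathbb{R}^n$. Let $\mathcal{C}\subset E_0$ be a pathwise connected subset of the set of equilibria of this system corresponding to control values in $\mathrm{int}(\Omega)$, and assume that for every equilibrium $x_u$ in $\mathcal{C}$ (with $u\in\mathrm{int}(\Omega)$) the rank condition $$\mathrm{rank}[B'(u),A(u)B'(u),\dots,A(u)^{n-1}B'(u)]=n,\qquad B'(u)=C+[B_1x_u,\dots,B_mx_u],$$ is satisfied. Then there exists a control set $D$ containing $\mathcal{C}$ in the interior, and $D=\mathcal{O}^-(x_u)\cap\overline{\mathcal{O}^+(x_u)}$ for every $x_u\in\mathcal{C}$.
   Context: Setting. $A,B_1,\dots,B_m\in\mathbb{R}^{n\times n}$, $c_1,\dots,c_m,d\in\mathbb{R}^n$, $C=(c_1,\dots,c_m)\in\mathbb{R}^{n\times m}$, $\Omega\subset\mathbb{R}^m$, $A(u)=A+\sum_{i=1}^mu_iB_i$, and $\mathcal{U}=\{u\in L^\infty(\mathbb{R},\mathbb{R}^m)\mid u(t)\in\Omega\text{ for almost all }t\}$. The solution of $\dot x=A(u(t))x+Cu(t)+d$ with $\varphi(0,x,u)=x$ is $\varphi(t,x,u)$, $t\in\mathbb{R}$. For $u\in\Omega$ an equilibrium for the control value $u$ is a point $x_u\in\mathbb{R}^n$ with $0=A(u)x_u+Cu+d$; $E_0=\{x\in\mathbb{R}^n\mid 0=A(u)x+Cu+d\text{ for some }u\in\mathrm{int}(\Omega)\}$. $\mathcal{O}^+(x)=\{\varphi(t,x,u)\mid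 t\ge0,u\in\mathcal{U}\}$ and $\mathcal{O}^-(x)=\{y\mid x=\varphi(t,y,u)\text{ for some }t\ge0,u\in\mathcal{U}\}$. A nonvoid set $D\subset\mathbb{R}^n$ is a control set if (i) for all $x\in D$ there is $u\in\mathcal{U}$ with $\varphi(t,x,u)\in D$ for all $t\ge0$; (ii) for all $x\in D$ one has $D\subset\overline{\mathcal{O}^+(x)}$; (iii) $D$ is maximal with these properties, i.e. if $D'\supset D$ satisfies (i) and (ii), then $D'=D$. *)

(* Defs.v *)
From HB Require Import structures.
From mathcomp Require Import all_boot all_order all_algebra.
From mathcomp Require Import all_classical all_reals all_analysis.

Set Implicit Arguments.
Unset Strict Implicit.
Unset Printing Implicit Defensive.

Import Order.TTheory GRing.Theory Num.Theory.
Import numFieldNormedType.Exports.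

Local Open Scope classical_set_scope.
Local Open Scope ring_scope.

Record affine_system (R : realType) (n m : nat) := AffineSystem {
  sysA : 'M[R]_n;
  sysB : 'I_m -> 'M[R]_n;
  sysC : 'M[R]_(n, m);
  sysd : 'cV[R]_n;
  sysOmega : set 'cV[R]_m }.

Section AffineControlSystem.
Context (R : realType) (n m : nat) (S : affine_system R n m).

Implicit Types (u : R -> 'cV[R]_m) (x y : 'cV[R]_n) (phi : R -> 'cV[R]_n).
Implicit Types (v : 'cV[R]_m) (D E : set 'cV[R]_n).

Local Notation mu := (@lebesgue_measure R).

Definition Amx v : 'M[R]_n := sysA S + \sum_(i < m) v i 0 *: sysB S i.

Definition vfield v x : 'cV[R]_n := Amx v *m x + sysC S *m v + sysd S.

(* [u] is a Borel representative of an element of L^oo(R, R^m). *)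
Definition control u : Prop :=
  (forall i : 'I_m, (fun t => u t i 0) \in Lfun mu +oo%E) /\
  {ae mu, forall t, sysOmega S (u t)}.

(* [phi] is the Caratheodory solution on the whole line, in integral form, for
   the control [u] and the initial condition [phi 0 = x].  For a control [u]
   the integrands are bounded on bounded intervals, hence integrable. *)
Definition solution u x phi : Prop :=
  [/\ continuous phi,
      phi 0 = x &
      forall a b : R, a <= b -> forall i : 'I_n,
        phi b i 0 - phi a i 0 =
        \int[mu]_(s in `[a, b]) (vfield (u s) (phi s)) i 0].

Definition orbit_pos x : set 'cV[R]_n :=
  [set y | exists t u phi, [/\ 0 <= t, control u, solution u x phi & phi t = y]].

Definition orbit_neg x : set 'cV[R]_n :=
  [set y | exists t u phi, [/\ 0 <= t, control u, solution u y phi & phi t = x]].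

Definition viable D : Prop :=
  forall x, D x -> exists u phi,
    [/\ control u, solution u x phi & forall t, 0 <= t -> D (phi t)].

Definition approx_controllable D : Prop :=
  forall x, D x -> D `<=` closure (orbit_pos x).

Definition control_set D : Prop :=
  [/\ D !=set0, viable D, approx_controllable D &
      forall E, D `<=` E -> viable E -> approx_controllable E -> E = D].

Definition equilibrium v x : Prop := vfield v x = 0.

Definition E0 : set 'cV[R]_n :=
  [set x | exists2 v, interior (sysOmega S) v & equilibrium v x].

(* B'(u) = C + [B_1 x, ..., B_m x], to be used with [x] an equilibrium for the
   control value [u]. *)
Definition Bprime x : 'M[R]_(n, m) :=
  sysC S + \matrix_(i < n, j < m) (sysB S j *m x) i 0.

Definition kalman v x : 'M[R]_(n, \sum_(k < n) m) :=
  \mxrow_(k < n) (Amx v ^+ k *m Bprime x).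

End AffineControlSystem.

(* Pathwise connected sets are nonempty by convention. *)
Definition pathwise_connected (R : realType) (T : topologicalType)
    (E : set T) : Prop :=
  E !=set0 /\
  forall x y, E x -> E y -> exists gamma : R -> T,
    [/\ {within `[0, 1], continuous gamma}, gamma 0 = x, gamma 1 = y &
        gamma @` `[0, 1] `<=` E].

(* Main.v *)
Require Import Defs.
From HB Require Import structures.
From mathcomp Require Import all_boot all_order all_algebra.
From mathcomp Require Import all_classical all_reals all_analysis.
From mathcomp Require Import measurable_realfun ess_sup_inf ring lra.

Set Implicit Arguments.
Unset Strict Implicit.
Unset Printing Implicit Defensive.

Import Order.TTheory GRing.Theory Num.Theory.
Import numFieldNormedType.Exports.

Local Open Scope classical_set_scope.
Local Open Scope ring_scope.

(** Fix [x] in the path of equilibria.  The whole theorem follows from one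
    local fact: the points that can be reached from [x], and the points from
    which [x] can be reached, both form neighbourhoods of [x].

    Granted this at every equilibrium of the path, being mutually reachable is
    an equivalence relation whose classes are open in the path, so
    connectedness leaves a single class.  Set D = O^-(x) /\ cl O^+(x).  It does
    not depend on [x], it contains a neighbourhood of every equilibrium of the
    path, and it is approximately controllable because every point of D can be
    steered to [x].  It is viable: steer to [x] and stay there.  The points met
    on the way remain in cl O^+(x), since solutions depend continuously on
    their initial value.  It is maximal: from a point [y] of a larger
    approximately controllable set one gets arbitrarily close to [x], hence
    into the neighbourhood O^-(x), so that [y] belongs to O^-(x)
    ([control_set_of_control_set]).

    The local fact ([local_controllability]) compares the bilinear system with
    its linearization z' = A z + B w at ([x], [v]).  Under the rank condition
    there are polynomial matrices Z and W with Z' = A Z + B W, Z(0) = 0 and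
    Z(1) = 1 ([polynomial_steering]); they come from the flat parametrization
    of linear systems, and their existence uses only the Cayley-Hamilton
    theorem and the vanishing order of polynomials at 0 and 1.  Applying the
    control v + W(t) s to the true system from [x], a Gronwall estimate shows
    that the displacement F(s) at time 1 differs from [s] by a map which is
    1/2-Lipschitz near 0.  A contraction argument then makes F onto a
    neighbourhood of 0 ([perturbed_identity_onto]).  The statement about O^-(x)
    is the same one for the system run backwards in time.

    For measurable controls the solutions of the system are provided by Picard
    iteration in the norm weighted by exp(- 2 K |t|), for which the iteration
    halves distances on the whole line ([picard_lindelof]); the same weight
    gives the Gronwall bound ([gronwall]).  Both rest on the calculus of
    functions F with F(b) - F(a) equal to the Lebesgue integral of g over
    [a, b] ([primitive]). *)

(** * Integrals of locally bounded measurable functions *)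

Section LocallyBounded.
Context {R : realType}.
Implicit Types (f g h F G : R -> R) (a b c t : R).
Local Notation mu := (@lebesgue_measure R).

(** A class of integrands that contains all continuous functions and all
    bounded measurable ones, is closed under sums and products, and consists
    of functions integrable on every bounded interval. *)
Definition locbdd_meas f : Prop :=
  measurable_fun [set: R] f /\
  forall T, exists K, forall t, `|t| <= T -> `|f t| <= K.

Definition primitive g F : Prop :=
  forall a b, a <= b -> F b - F a = \int[mu]_(s in `[a, b]) g s.

Lemma locbdd_meas_cst c : locbdd_meas (fun=> c).
Proof. by split=> [|T]; [exact: measurable_cst|exists `|c|]. Qed.

Lemma locbdd_measD f g :
  locbdd_meas f -> locbdd_meas g -> locbdd_meas (fun t => f t + g t).
Proof.
move=> [mf bf] [mg bg]; split=> [|T]; first exact: measurable_funD.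
have [K Kf] := bf T; have [L Lg] := bg T.
exists (K + L) => t tT; apply: le_trans (ler_normD _ _) _.
by rewrite lerD ?Kf ?Lg.
Qed.

Lemma locbdd_measM f g :
  locbdd_meas f -> locbdd_meas g -> locbdd_meas (fun t => f t * g t).
Proof.
move=> [mf bf] [mg bg]; split=> [|T]; first exact: measurable_funM.
have [K Kf] := bf T; have [L Lg] := bg T.
by exists (K * L) => t tT; rewrite normrM ler_pM ?Kf ?Lg.
Qed.

Lemma locbdd_measN f : locbdd_meas f -> locbdd_meas (fun t => - f t).
Proof.
move=> bf; under eq_fun do rewrite -mulN1r.
by apply: locbdd_measM => //; exact: locbdd_meas_cst.
Qed.

Lemma locbdd_measB f g :
  locbdd_meas f -> locbdd_meas g -> locbdd_meas (fun t => f t - g t).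
Proof. by move=> bf bg; apply: locbdd_measD => //; exact: locbdd_measN. Qed.

Lemma locbdd_meas_continuous f : continuous f -> locbdd_meas f.
Proof.
move=> cf; split=> [|T].
  exact: continuous_measurable_fun.
have [T0|T0] := leP 0 T; last first.
  by exists 0 => t tT; move: (le_lt_trans tT T0); rewrite normr_lt0.
have cn : {within `[- T, T], continuous (fun t => `|f t|)}.
  apply: continuous_subspaceT => x; apply: (@continuous_comp _ _ _ f).
    exact: cf.
  exact: norm_continuous.
have TT : - T <= T by lra.
have [c _ cmax] := EVT_max TT cn.
by exists `|f c| => t; rewrite ler_norml => tT; apply: cmax; rewrite in_itv.
Qed.

Lemma locbdd_meas_reflect c f :
  locbdd_meas f -> locbdd_meas (fun t => f (c - t)).
Proof.
move=> [mf bf]; split=> [|T].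
  apply: (measurableT_comp mf).
  by apply: measurable_funB => //; exact: measurable_cst.
have [K Kf] := bf (`|c| + T); exists K => t tT; apply: Kf.
by apply: le_trans (ler_normB _ _) _; rewrite lerD2l.
Qed.

Lemma locbdd_meas_glue c f g :
  locbdd_meas f -> locbdd_meas g ->
  locbdd_meas (fun t => if t <= c then f t else g t).
Proof.
move=> [mf bf] [mg bg]; split=> [|T].
  apply: measurable_fun_ifT => //.
  by apply: measurable_fun_ler => //; exact: measurable_cst.
have [K Kf] := bf T; have [L Lg] := bg T.
exists (Num.max K L) => t tT; rewrite le_max.
by case: ifP => _; rewrite ?Kf ?Lg ?orbT.
Qed.

Lemma integrable_locbdd a b f :
  locbdd_meas f -> mu.-integrable `[a, b] (EFin \o f).
Proof.
move=> [mf bf]; apply: measurable_bounded_integrable => //=.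
- rewrite lebesgue_measure_itv/=; case: ifP => // _.
  by rewrite -EFinB ltry.
- exact: measurable_funS mf.
- have [K Kf] := bf (Num.max `|a| `|b|).
  exists K; split; first exact: num_real.
  move=> L KL t /=; rewrite in_itv/= => /andP[at' tb].
  apply: le_trans (ltW KL); apply: Kf.
  rewrite le_max; have [t0|t0] := leP 0 t.
    by rewrite [`|b|]ger0_norm ?(le_trans t0)// ger0_norm// tb orbT.
  by rewrite [`|a|]ltr0_norm ?(le_lt_trans at')// ltr0_norm// lerN2 at'.
Qed.

Lemma integral_locbdd_cat a c b f : locbdd_meas f -> a <= c -> c <= b ->
  \int[mu]_(s in `[a, b]) f s =
  \int[mu]_(s in `[a, c]) f s + \int[mu]_(s in `[c, b]) f s.
Proof.
move=> bf ac cb.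
have H : \int[mu]_(s in `[a, b]) f s - \int[mu]_(s in `[a, c]) f s =
    \int[mu]_(s in `]c, b]) f s.
  by apply: Rintegral_itvB; rewrite ?bnd_simp//; exact: integrable_locbdd.
rewrite Rintegral_itv_obnd_cbnd in H; first by rewrite -H addrC subrK.
apply: (@integrableS _ _ _ mu `[c, b]) => //; last exact: integrable_locbdd.
by apply: subset_itvr; rewrite bnd_simp.
Qed.

Lemma primitiveB g1 F1 g2 F2 : locbdd_meas g1 -> locbdd_meas g2 ->
  primitive g1 F1 -> primitive g2 F2 ->
  primitive (fun s => g1 s - g2 s) (fun t => F1 t - F2 t).
Proof.
move=> b1 b2 p1 p2 a b ab; rewrite RintegralB//; last 2 first.
- exact: integrable_locbdd.
- exact: integrable_locbdd.
rewrite -p1// -p2//; ring.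
Qed.

(** Every estimate below is obtained by comparison with an explicit
    majorant [h] of the integrand whose primitive [H] is known. *)
Lemma primitive_bound g F h H a b : a <= b ->
  locbdd_meas g -> locbdd_meas h -> primitive g F -> primitive h H ->
  (forall s, a <= s <= b -> `|g s| <= h s) -> `|F b - F a| <= H b - H a.
Proof.
move=> ab bg bh pg ph gh; rewrite pg// ph//.
apply: le_trans (le_normr_Rintegral _ _) _ => //.
  exact: integrable_locbdd.
apply: le_Rintegral => //.
- have bng : locbdd_meas (fun t => `|g t|).
    case: bg => mg bg; split; first exact: measurableT_comp.
    by move=> T; have [K Kg] := bg T; exists K => t /Kg; rewrite normr_id.
  exact: (integrable_locbdd a b bng).
- exact: integrable_locbdd.
Qed.

Lemma primitive_C1 g F : continuous g ->
  (forall x : R, is_derive x (1 : R) F (g x)) -> primitive g F.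
Proof.
move=> cg dF a b; rewrite le_eqVlt => /predU1P[->|ab].
  by rewrite subrr set_itv1 Rintegral_set1.
have dF1 x : derivable F x 1 by case: (dF x).
rewrite /Rintegral (@continuous_FTC2 _ _ F)//.
- exact: continuous_subspaceT.
- split=> [x _||]; first exact: dF1.
    apply: cvg_at_right_filter.
    by apply: differentiable_continuous; exact/derivable1_diffP.
  apply: cvg_at_left_filter.
  by apply: differentiable_continuous; exact/derivable1_diffP.
- by move=> x _; rewrite derive1E derive_val.
Qed.

Definition reflection c (t : measurableTypeR R) : measurableTypeR R := c - t.

Lemma measurable_reflection c : measurable_fun setT (reflection c).
Proof. by apply: measurable_funB => //; exact: measurable_cst. Qed.

HB.instance Definition _ c :=
  isMeasurableFun.Build _ _ _ _ _ (@measurable_reflection c).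

Lemma reflection_itv c (x y : bool) a b :
  reflection c @^-1` [set` Interval (BSide x a) (BSide y b)] =
  [set` Interval (BSide (~~ y) (c - b)) (BSide (~~ x) (c - a))].
Proof.
by apply/seteqP; split=> s; rewrite /= !in_itv/= /reflection;
  case: x; case: y => /=; lra.
Qed.

(** Reflections suffice for all changes of variable needed here: a
    translation is the product of two of them. *)
Lemma lebesgue_measure_reflection c (A : set R) : measurable A ->
  pushforward mu (reflection c) A = mu A.
Proof.
move=> mA; apply/esym/lebesgue_measure_unique => //= _ [[a b]] _ <-.
rewrite /pushforward/= reflection_itv !lebesgue_measure_itv/= !lte_fin.
rewrite ltrD2l ltrN2; case: ifP => // _.
by rewrite -!EFinB; congr (_%:E); ring.
Qed.

Lemma integral_reflection c f a b : locbdd_meas f ->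
  \int[mu]_(s in `[a, b]) f s = \int[mu]_(s in `[c - b, c - a]) f (c - s).
Proof.
move=> bf; rewrite /Rintegral; congr fine.
transitivity (\int[pushforward mu (reflection c)]_(x in `[a, b]) (f x)%:E)%E.
  apply: eq_measure_integral => A mA _.
  exact/esym/lebesgue_measure_reflection.
rewrite integral_pushforward//=.
- by rewrite reflection_itv.
- by apply/measurable_EFinP; case: bf.
- rewrite reflection_itv/=.
  exact: (integrable_locbdd _ _ (locbdd_meas_reflect c bf)).
Qed.

Lemma primitive_reflect c g F : locbdd_meas g -> primitive g F ->
  primitive (fun s => - g (c - s)) (fun t => F (c - t)).
Proof.
move=> bg pF a b ab.
have := @RintegralZl _ _ _ mu `[a, b] (fun s => g (c - s)) (-1).
under eq_Rintegral do rewrite mulN1r.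
move=> ->//; last exact: (integrable_locbdd _ _ (locbdd_meas_reflect c bg)).
have := integral_reflection c (c - b) (c - a) bg; rewrite !subKr => <-.
by rewrite -pF ?lerD2l ?lerN2//; ring.
Qed.

Lemma primitive_glue c g1 F1 g2 F2 : locbdd_meas g1 -> locbdd_meas g2 ->
  primitive g1 F1 -> primitive g2 F2 -> F1 c = F2 c ->
  primitive (fun s => if s <= c then g1 s else g2 s)
            (fun t => if t <= c then F1 t else F2 t).
Proof.
move=> b1 b2 p1 p2 F12 a b ab.
have left x y : y <= c -> \int[mu]_(s in `[x, y])
    (if s <= c then g1 s else g2 s) = \int[mu]_(s in `[x, y]) g1 s.
  move=> yc; apply: eq_Rintegral => s; rewrite inE/= in_itv/= => /andP[_ sy].
  by rewrite (le_trans sy yc).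
have right x y : c <= x -> \int[mu]_(s in `[x, y])
    (if s <= c then g1 s else g2 s) = \int[mu]_(s in `[x, y]) g2 s.
  move=> cx; have [xy|yx] := leP x y; last first.
    by rewrite set_itv_ge ?bnd_simp -?ltNge// !Rintegral_set0.
  rewrite -Rintegral_itv_obnd_cbnd; last first.
    apply: (@integrableS _ _ _ mu `[x, y]) => //.
      by apply: subset_itvr; rewrite bnd_simp.
    exact: (integrable_locbdd _ _ (locbdd_meas_glue c b1 b2)).
  rewrite -[RHS]Rintegral_itv_obnd_cbnd; last first.
    apply: (@integrableS _ _ _ mu `[x, y]) => //.
      by apply: subset_itvr; rewrite bnd_simp.
    exact: integrable_locbdd.
  apply: eq_Rintegral => s; rewrite inE/= in_itv/= => /andP[xs _].
  by rewrite leNgt (le_lt_trans cx xs).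
have [bc|cb] := leP b c; first by rewrite left// (le_trans ab bc) p1.
have [ac|ca] := leP a c; last by rewrite right ?(ltW ca)// p2.
rewrite (@integral_locbdd_cat a c b) ?(ltW cb)//; last exact: locbdd_meas_glue.
rewrite left// right// -p1// -p2 ?(ltW cb)// F12; ring.
Qed.

(** The primitive vanishing at 0, on the whole line. *)
Definition signed_integral g t : R :=
  if 0 <= t then \int[mu]_(s in `[0, t]) g s
  else - \int[mu]_(s in `[t, 0]) g s.

Lemma signed_integral0 g : signed_integral g 0 = 0.
Proof. by rewrite /signed_integral lexx set_itv1 Rintegral_set1. Qed.

Lemma primitive_signed_integral g :
  locbdd_meas g -> primitive g (signed_integral g).
Proof.
move=> bg a b ab; rewrite /signed_integral.
have [b0|b0] := leP 0 b; have [a0|a0] := leP 0 a.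
- by rewrite (@integral_locbdd_cat 0 a b)//; ring.
- by rewrite (@integral_locbdd_cat a 0 b) ?(ltW a0)//; ring.
- by have := le_lt_trans a0 (le_lt_trans ab b0); rewrite ltxx.
- by rewrite (@integral_locbdd_cat a b 0) ?(ltW b0)//; ring.
Qed.

Lemma primitive_cst K : primitive (fun=> K) (fun t => K * t).
Proof.
move=> a b; rewrite le_eqVlt => /predU1P[->|ab].
  by rewrite subrr set_itv1 Rintegral_set1.
by rewrite Rintegral_cst//= lebesgue_measure_itv/= lte_fin ab mulrBr.
Qed.

(** The primitive is Lipschitz on bounded sets, with the local bound of the
    integrand as constant. *)
Lemma primitive_continuous g F : locbdd_meas g -> primitive g F ->
  continuous F.
Proof.
move=> bg pF x.
have [K Kg] := bg.2 (`|x| + 1).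
apply/cvgrPdist_le => e e0.
have K0 : 0 <= K by apply: le_trans (Kg x _); rewrite ?lerDl.
have bound a b : a <= b -> (forall s, a <= s <= b -> `|s| <= `|x| + 1) ->
    `|F b - F a| <= K * (b - a).
  move=> ab abx; rewrite mulrBr.
  apply: (primitive_bound ab bg _ pF (primitive_cst K)) => [|s /abx].
    exact: locbdd_meas_cst.
  exact: Kg.
have d0 : 0 < Num.min 1 (e / (K + 1)) by rewrite lt_min ltr01 divr_gt0//; lra.
near=> y.
have xy : `|x - y| <= Num.min 1 (e / (K + 1)).
  by near: y; apply: (@cvgr_dist_le _ _ _ (nbhs x) _ id x).
move: xy; rewrite le_min => /andP[xy1 xye].
have near1 s : `|x - s| <= `|x - y| -> `|s| <= `|x| + 1.
  move=> sy; have -> : s = x - (x - s) by ring.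
  by apply: le_trans (ler_normB _ _) _; rewrite lerD2l (le_trans sy).
apply: (@le_trans _ _ (K * `|x - y|)); last first.
  apply: (@le_trans _ _ ((K + 1) * `|x - y|)).
    by rewrite ler_wpM2r// lerDl.
  by rewrite mulrC -ler_pdivlMr//; lra.
have [xley|/ltW ylex] := leP x y.
  rewrite distrC [X in K * X]distrC [X in K * X]ger0_norm ?subr_ge0//.
  apply: bound => // s /andP[xs sy]; apply: near1.
  by rewrite distrC [leRHS]distrC !ger0_norm ?subr_ge0 ?lerB//; lra.
rewrite [X in K * X]ger0_norm ?subr_ge0//.
apply: bound => // s /andP[ys sx]; apply: near1.
by rewrite !ger0_norm ?subr_ge0//; lra.
Unshelve. all: by end_near. Qed.

End LocallyBounded.

(** * Column vectors and geometric convergence *)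

Section Vectors.
Context {R : realType} {n : nat}.
Implicit Types (x y v : 'cV[R]_n) (phi : R -> 'cV[R]_n).

Lemma cV_subE x y i : (x - y) i 0 = x i 0 - y i 0.
Proof. by rewrite !mxE. Qed.

Lemma cV_norm_le v c : 0 <= c -> (forall i, `|v i 0| <= c) -> `|v| <= c.
Proof.
move=> c0 vc; rewrite [leLHS]/Num.norm/= mx_normrE.
by apply/bigmax_leP; split=> // -[i j] _ /=; rewrite ord1.
Qed.

Lemma cV_norm_ge v i : `|v i 0| <= `|v|.
Proof.
rewrite [leRHS]/Num.norm/= mx_normrE.
by apply/bigmax_geP; right; exists (i, 0).
Qed.

Lemma cV_continuousP phi :
  (forall i, continuous (fun t => phi t i 0)) -> continuous phi.
Proof.
move=> cphi t; apply/cvgrPdist_le => e e0; near=> s.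
apply: cV_norm_le; first exact: ltW.
near: s; apply: filter_forall => i.
under eq_near do rewrite !mxE.
exact: cvgr_dist_le (cphi i t) e e0.
Unshelve. all: by end_near. Qed.

Lemma cV_coord_continuous phi i :
  continuous phi -> continuous (fun t => phi t i 0).
Proof.
move=> cphi t; apply: (@continuous_comp _ _ _ phi (fun v => v i 0)).
  exact: cphi.
exact: (@coord_continuous _ _ _ i 0 (phi t)).
Qed.

Lemma norm_curve_continuous phi :
  continuous phi -> continuous (fun t => `|phi t|).
Proof.
move=> cphi t; apply: (@continuous_comp _ _ _ phi); first exact: cphi.
exact: norm_continuous.
Qed.

End Vectors.

Section GeometricSequences.
Context {R : realType}.

Lemma le0_geometric (x C : R) :
  (forall k, x <= C * 2^-1 ^+ k) -> x <= 0.
Proof.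
move=> xC; rewrite leNgt; apply/negP => x0.
have C0 : 0 < C by have := xC 0%N; rewrite expr0 mulr1; exact: lt_le_trans.
have h : 0 < x / C by rewrite divr_gt0.
have [k _] : exists2 k : nat, True & 2^-1 ^+ k < x / C.
  have /cvgrPdist_lt/(_ _ h) :
      (fun k : nat => (2^-1 : R) ^+ k) @ \oo --> (0 : R).
    by apply: cvg_expr; rewrite ger0_norm ?invr_ge0//; lra.
  move=> [N _ /(_ N)] /= /(_ (leqnn _)); rewrite sub0r normrN => hN.
  by exists N => //; apply: le_lt_trans hN; exact: ler_norm.
by rewrite ltr_pdivlMr// mulrC ltNge xC.
Qed.

(** Adding and subtracting the remaining geometric tail [r k] turns the
    sequence into a nondecreasing one lying below a nonincreasing one; the
    supremum of the former is the limit and comes with its error bound. *)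
Lemma real_geometric_limit (u : nat -> R) (c : R) :
  (forall k, `|u k.+1 - u k| <= c * 2^-1 ^+ k) ->
  exists l, forall k, `|l - u k| <= 2 * c * 2^-1 ^+ k.
Proof.
move=> uc; pose r k := 2 * c * 2^-1 ^+ k.
have rS k : r k = c * 2^-1 ^+ k + r k.+1.
  by rewrite /r exprS; field.
have lo k : u k - r k <= u k.+1 - r k.+1.
  by have := uc k; rewrite (rS k) ler_norml => /andP[]; lra.
have hi k : u k.+1 + r k.+1 <= u k + r k.
  by have := uc k; rewrite (rS k) ler_norml => /andP[]; lra.
have c0 : 0 <= c by have := uc 0%N; rewrite expr0 mulr1; exact: le_trans.
have r0 k : 0 <= r k by rewrite /r !mulr_ge0 ?exprn_ge0 ?invr_ge0.
have lom j k : (j <= k)%N -> u j - r j <= u k - r k.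
  move=> /subnK <-; elim: (k - j)%N => [//|i ih]; rewrite addSn.
  exact: le_trans ih (lo _).
have him j k : (j <= k)%N -> u k + r k <= u j + r j.
  move=> /subnK <-; elim: (k - j)%N => [//|i ih]; rewrite addSn.
  exact: le_trans (hi _) ih.
have lohi j k : u j - r j <= u k + r k.
  have [jk|/ltnW kj] := leqP j k.
    by apply: le_trans (lom _ _ jk) _; have := r0 k; lra.
  by apply: le_trans (him _ _ kj); have := r0 j; lra.
pose A := range (fun k => u k - r k).
have supA : has_sup A.
  by split; [exists (u 0%N - r 0%N), 0%N|exists (u 0%N + r 0%N) => _ [k _ <-]].
exists (sup A) => k; rewrite -/(r k) ler_norml.
have h1 : u k - r k <= sup A.
  by apply: ub_le_sup; [case: supA|exists k].
have h2 : sup A <= u k + r k.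
  by apply: ge_sup; [case: supA|move=> _ [j _ <-]].
by lra.
Qed.

Lemma cV_geometric_limit n (u : nat -> 'cV[R]_n) (c : R) :
  (forall k, `|u k.+1 - u k| <= c * 2^-1 ^+ k) ->
  exists l, forall k, `|l - u k| <= 2 * c * 2^-1 ^+ k.
Proof.
move=> uc.
have c0 : 0 <= c by have := uc 0%N; rewrite expr0 mulr1; exact: le_trans.
have /choice[l lP] : forall i, exists l : R, forall k,
    `|l - u k i 0| <= 2 * c * 2^-1 ^+ k.
  move=> i; apply: real_geometric_limit => k; apply: le_trans (uc k).
  by apply: le_trans (cV_norm_ge _ i); rewrite !mxE.
exists (\col_i l i) => k; apply: cV_norm_le => [|i]; last by rewrite !mxE.
by rewrite mulr_ge0 ?exprn_ge0 ?invr_ge0// mulr_ge0.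
Qed.

End GeometricSequences.

(** * Existence and stability for integral equations *)

Section WeightedBound.
Context {R : realType}.
Local Notation mu := (@lebesgue_measure R).
Implicit Types (g F : R -> R).

Lemma expR_ge1 (r : R) : 0 <= r -> 1 <= expR r.
Proof. by move=> r0; rewrite -(@expR0 R) ler_expR. Qed.

Lemma expRM_continuous (c L : R) : continuous (fun s => c * expR (L * s)).
Proof.
move=> s; apply: cvgM; first exact: cvg_cst.
apply: (@continuous_comp _ _ _ (fun s => L * s) expR).
  by apply: cvgM; [exact: cvg_cst|exact: cvg_id].
exact: continuous_expR.
Qed.

Lemma primitive_expR (c L : R) : L != 0 ->
  primitive (fun s => c * expR (L * s)) (fun t => c / L * expR (L * t)).
Proof.
move=> L0; apply: primitive_C1; first exact: expRM_continuous.
move=> x.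
have dL : is_derive x (1 : R) ( *%R L) L.
  by apply: is_derive_eq; exact: mulr1.
have dE : is_derive x (1 : R) (expR \o ( *%R L)) (expR (L * x) * L).
  exact: is_derive1_comp.
by apply: is_derive_eq; rewrite /GRing.scale/=; field.
Qed.

(** Integrating [expR (L * `|s|)] divides it by [L].  A large [L] thus beats
    any Lipschitz constant, uniformly in time. *)
Lemma weighted_bound g F (c L t : R) : 0 < L -> 0 <= c ->
  locbdd_meas g -> primitive g F ->
  (forall s, `|s| <= `|t| -> `|g s| <= c * expR (L * `|s|)) ->
  `|F t - F 0| <= c / L * expR (L * `|t|).
Proof.
move=> L0 c0 bg pF gc.
have cL : 0 <= c / L by rewrite divr_ge0// ltW.
have [t0|t0] := leP 0 t.
  have := primitive_bound t0 bg _ pF (@primitive_expR c L _).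
  move=> /(_ (locbdd_meas_continuous (@expRM_continuous c L))).
  move=> /(_ (lt0r_neq0 L0)) H; apply: le_trans (H _) _.
    move=> s /andP[s0 st].
    have -> : expR (L * s) = expR (L * `|s|) by rewrite ger0_norm.
    by apply: gc; rewrite !ger0_norm.
  by rewrite mulr0 expR0 mulr1 ger0_norm// lerBlDr lerDl.
rewrite distrC; have L'0 : - L != 0 by rewrite oppr_eq0 lt0r_neq0.
have := primitive_bound (ltW t0) bg _ pF (@primitive_expR c (- L) L'0).
move=> /(_ (locbdd_meas_continuous (@expRM_continuous c (- L)))) H.
apply: le_trans (H _) _.
  move=> s /andP[ts s0]; have -> : expR (- L * s) = expR (L * `|s|).
    by rewrite ler0_norm// mulNr mulrN.
  by apply: gc; rewrite !ler0_norm ?lerN2// (le_trans ts).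
have -> : expR (- L * t) = expR (L * `|t|) by rewrite ltr0_norm// mulNr mulrN.
by rewrite mulr0 expR0 invrN mulrN; lra.
Qed.

End WeightedBound.

Section Caratheodory.
Context {R : realType} {n : nat}.
Local Notation mu := (@lebesgue_measure R).
Implicit Types (f : R -> 'cV[R]_n -> 'cV[R]_n) (phi : R -> 'cV[R]_n).

Definition cV_locbdd_meas (g : R -> 'cV[R]_n) : Prop :=
  forall i, locbdd_meas (fun s => g s i 0).

Definition cV_primitive (g F : R -> 'cV[R]_n) : Prop :=
  forall i, primitive (fun s => g s i 0) (fun t => F t i 0).

Definition ode_solution f phi : Prop :=
  continuous phi /\ cV_primitive (fun s => f s (phi s)) phi.

(** The right-hand side need only be measurable in time, so that measurable
    controls are covered; the Lipschitz condition is global in space, as it is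
    for a system affine in the state with a bounded control. *)
Definition caratheodory f (K : R) : Prop :=
  [/\ 0 < K,
      forall phi, continuous phi -> cV_locbdd_meas (fun s => f s (phi s)),
      forall s x y, `|f s x - f s y| <= K * `|x - y| &
      forall x, exists c, forall s, `|f s x| <= c].

Lemma cV_primitive_continuous g F :
  cV_locbdd_meas g -> cV_primitive g F -> continuous F.
Proof.
move=> bg pF; apply: cV_continuousP => i.
exact: (primitive_continuous (bg i) (pF i)).
Qed.

Lemma cV_locbdd_measB g1 g2 : cV_locbdd_meas g1 -> cV_locbdd_meas g2 ->
  cV_locbdd_meas (fun s => g1 s - g2 s).
Proof.
move=> b1 b2 i; under eq_fun do rewrite cV_subE.
exact: locbdd_measB.
Qed.

Lemma cV_primitiveB g1 F1 g2 F2 : cV_locbdd_meas g1 -> cV_locbdd_meas g2 ->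
  cV_primitive g1 F1 -> cV_primitive g2 F2 ->
  cV_primitive (fun s => g1 s - g2 s) (fun t => F1 t - F2 t).
Proof.
move=> b1 b2 p1 p2 i.
have -> : (fun s => (g1 s - g2 s) i 0) = (fun s => g1 s i 0 - g2 s i 0).
  by apply/funext => s; rewrite cV_subE.
have -> : (fun t => (F1 t - F2 t) i 0) = (fun t => F1 t i 0 - F2 t i 0).
  by apply/funext => t; rewrite cV_subE.
exact: primitiveB.
Qed.

Lemma cV_weighted_bound g F (c L t : R) : 0 < L -> 0 <= c ->
  cV_locbdd_meas g -> cV_primitive g F ->
  (forall s, `|s| <= `|t| -> `|g s| <= c * expR (L * `|s|)) ->
  `|F t - F 0| <= c / L * expR (L * `|t|).
Proof.
move=> L0 c0 bg pF gc; apply: cV_norm_le => [|i].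
  by rewrite mulr_ge0 ?expR_ge0// divr_ge0// ltW.
rewrite !mxE; apply: weighted_bound (bg i) (pF i) _ => // s st.
exact: le_trans (cV_norm_ge _ i) (gc s st).
Qed.

(** Let [m] be the maximum of [`|e s|], weighted by [expR (- 2 * K * `|s|)],
    on the interval.  Integrating the hypothesis with the weight gives
    [m <= `|e 0| + m / 2 + c / (2 * K)]; solving for [m] is the claim. *)
Lemma gronwall g e (K c T : R) : 0 < K -> 0 <= c ->
  cV_locbdd_meas g -> cV_primitive g e ->
  (forall s, `|s| <= T -> `|g s| <= K * `|e s| + c) ->
  forall t, `|t| <= T ->
    `|e t| <= (2 * `|e 0| + c / K) * expR (2 * K * `|t|).
Proof.
move=> K0 c0 bg pe gK t tT.
have T0 : 0 <= T := le_trans (normr_ge0 _) tT.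
pose w s := `|e s| * expR (- (2 * K) * `|s|).
have cw : continuous w.
  move=> s; apply: cvgM.
    exact: norm_curve_continuous (cV_primitive_continuous bg pe) s.
  apply: (@continuous_comp _ _ _ (fun s : R => - (2 * K) * `|s|) expR).
    by apply: cvgM; [exact: cvg_cst|exact: norm_continuous].
  exact: continuous_expR.
have TT : - T <= T by lra.
have [r + rmax] := EVT_max TT (continuous_subspaceT cw).
rewrite in_itv/= -ler_norml => rT; set m := w r in rmax.
have em s : `|s| <= T -> `|e s| <= m * expR (2 * K * `|s|).
  move=> sT; have /rmax : s \in `[- T, T] by rewrite in_itv/= -ler_norml.
  by rewrite /w mulNr expRN ler_pdivrMr ?expR_gt0.
have m0 : 0 <= m by rewrite mulr_ge0 ?expR_ge0.
have m1 s : 1 <= expR (2 * K * `|s|).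
  by apply: expR_ge1; rewrite mulr_ge0// mulr_ge0// ltW.
have er : `|e r - e 0| <= (K * m + c) / (2 * K) * expR (2 * K * `|r|).
  apply: cV_weighted_bound bg pe _; [lra|by rewrite addr_ge0// mulr_ge0// ltW|].
  move=> s sr; have sT := le_trans sr rT.
  apply: le_trans (gK _ sT) _; rewrite mulrDl lerD//.
    by rewrite -mulrA ler_wpM2l ?(ltW K0)// em.
  by rewrite ler_peMr.
have mb : m <= 2 * `|e 0| + c / K.
  have : `|e r| <= (`|e 0| + (K * m + c) / (2 * K)) * expR (2 * K * `|r|).
    rewrite -[e r](subrK (e 0)) (le_trans (ler_normD _ _))//.
    rewrite addrC mulrDl lerD// ler_peMr//.
  rewrite -ler_pdivrMr ?expR_gt0// -expRN -mulNr -/(w r) -/m.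
  have -> : (K * m + c) / (2 * K) = m / 2 + c / K / 2 by field; lra.
  lra.
apply: le_trans (em _ tT) _.
by rewrite ler_wpM2r ?expR_ge0.
Qed.

Lemma uniform_limit_continuous phi :
  (forall T e : R, 0 < e -> exists2 h : R -> 'cV[R]_n, continuous h &
     forall t, `|t| <= T -> `|phi t - h t| <= e) -> continuous phi.
Proof.
move=> H t; apply/cvgrPdist_le => e e0.
have e3 : 0 < e / 3 by rewrite divr_gt0.
have [h ch hP] := H (`|t| + 1) _ e3.
near=> s.
have ts : `|t - s| <= 1.
  by near: s; apply: (@cvgr_dist_le _ _ _ (nbhs t) _ id t).
have hts : `|h t - h s| <= e / 3 by near: s; exact: cvgr_dist_le (ch t) _ e3.
have h1 : `|phi t - h t| <= e / 3 by apply: hP; rewrite lerDl.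
have h2 : `|phi s - h s| <= e / 3.
  apply: hP; have -> : s = t - (t - s) by ring.
  by apply: le_trans (ler_normB _ _) _; rewrite lerD2l.
have -> : phi t - phi s = (phi t - h t) + (h t - h s) - (phi s - h s).
  by apply/matrixP => i j; rewrite !mxE; ring.
apply: le_trans (ler_normB _ _) _.
apply: le_trans (lerD (ler_normD _ _) h2) _.
by lra.
Unshelve. all: by end_near. Qed.

Section Picard.
Variables (f : R -> 'cV[R]_n -> 'cV[R]_n) (K : R) (x : 'cV[R]_n).
Hypothesis fK : caratheodory f K.

Fixpoint picard_iterate (k : nat) : R -> 'cV[R]_n :=
  if k is k'.+1 then
    fun t => x + \col_i signed_integral
      (fun s => f s (picard_iterate k' s) i 0) t
  else fun=> x.

Lemma picard_iterate_prop k : continuous (picard_iterate k) /\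
  cV_primitive (fun s => f s (picard_iterate k s)) (picard_iterate k.+1).
Proof.
have [_ fm _ _] := fK.
have step g : cV_locbdd_meas g ->
    cV_primitive g (fun t => x + \col_i signed_integral (fun s => g s i 0) t).
  move=> bg i a b ab; rewrite !mxE -(primitive_signed_integral (bg i))//.
  by rewrite opprD addrACA subrr add0r.
elim: k => [|k [ck pk]]; split.
- exact: cst_continuous.
- by apply: step; apply: fm; exact: cst_continuous.
- by apply: cV_primitive_continuous pk; exact: fm.
- by apply: step; apply: (fm); apply: cV_primitive_continuous pk; exact: fm.
Qed.

Lemma picard_iterate0 k : picard_iterate k 0 = x.
Proof.
case: k => //= k; apply/matrixP => i j.
by rewrite !mxE signed_integral0 addr0 ord1.
Qed.

(** With weight exponent [2 * K], each iteration multiplies the distance by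
    [K / (2 * K)], one half. *)
Lemma picard_iterate_step : exists2 c, 0 <= c & forall k t,
  `|picard_iterate k.+1 t - picard_iterate k t| <=
    c * expR (2 * K * `|t|) * 2^-1 ^+ k.
Proof.
have [K0 fm flip fb] := fK; have [c fc] := fb x.
have c0 : 0 <= c := le_trans (normr_ge0 _) (fc 0).
have K2 : 0 < 2 * K by lra.
exists (c / (2 * K)); first by rewrite divr_ge0// ltW.
elim=> [|k ih] t.
  rewrite expr0 mulr1.
  have [ck pk] := picard_iterate_prop 0.
  rewrite -[X in _ - X](picard_iterate0 1).
  apply: (@cV_weighted_bound _ _ c (2 * K) t K2 c0 (fm _ ck) pk).
  move=> s _; apply: le_trans (fc s) _.
  by rewrite ler_peMr//; apply: expR_ge1; rewrite mulr_ge0// ltW.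
have [ck pk] := picard_iterate_prop k.
have [ck1 pk1] := picard_iterate_prop k.+1.
pose e t := picard_iterate k.+2 t - picard_iterate k.+1 t.
pose g s := f s (picard_iterate k.+1 s) - f s (picard_iterate k s).
have bg : cV_locbdd_meas g by apply: cV_locbdd_measB; exact: fm.
have pe : cV_primitive g e by apply: cV_primitiveB pk1 pk; exact: fm.
rewrite -/(e t); have <- : e t - e 0 = e t.
  by rewrite /e !picard_iterate0 subrr subr0.
have -> : c / (2 * K) * expR (2 * K * `|t|) * 2^-1 ^+ k.+1 =
    (K * (c / (2 * K)) * 2^-1 ^+ k) / (2 * K) * expR (2 * K * `|t|).
  by rewrite exprS; field; lra.
apply: cV_weighted_bound bg pe _ => //.
  by rewrite !mulr_ge0 ?exprn_ge0 ?invr_ge0// ltW.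
move=> s _; apply: le_trans (flip _ _ _) _.
rewrite -!mulrA ler_wpM2l ?(ltW K0)//; apply: le_trans (ih s) _.
by rewrite -!mulrA [expR _ * _]mulrC.
Qed.

(** By [picard_iterate_step] the iterates converge geometrically, uniformly on
    bounded intervals, so the limit is continuous and the integral equation
    passes to the limit. *)
Lemma picard_lindelof : exists2 phi, ode_solution f phi & phi 0 = x.
Proof.
have [K0 fm flip fb] := fK; have [c c0 step] := picard_iterate_step.
have /choice[phi phiP] : forall t, exists l, forall k,
    `|l - picard_iterate k t| <= 2 * (c * expR (2 * K * `|t|)) * 2^-1 ^+ k.
  by move=> t; apply: cV_geometric_limit => k; exact: step.
have unif T k t : `|t| <= T -> `|phi t - picard_iterate k t| <=
    2 * (c * expR (2 * K * T)) * 2^-1 ^+ k.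
  move=> tT; apply: le_trans (phiP t k) _.
  rewrite ler_wpM2r ?exprn_ge0 ?invr_ge0// ler_wpM2l// ler_wpM2l// ler_expR.
  by rewrite ler_wpM2l//; lra.
have cphi : continuous phi.
  apply: uniform_limit_continuous => T e e0.
  have [k kP] : exists k, 2 * (c * expR (2 * K * T)) * 2^-1 ^+ k < e.
    apply: contrapT => H; suff : e <= 0 by lra.
    apply: (@le0_geometric _ _ (2 * (c * expR (2 * K * T)))) => k.
    by rewrite leNgt; apply/negP => hk; apply: H; exists k.
  exists (picard_iterate k); first by have [] := picard_iterate_prop k.
  by move=> t tT; apply: le_trans (ltW kP); exact: unif.
exists phi; last first.
  apply/eqP; rewrite -subr_eq0 -normr_eq0 eq_le normr_ge0 andbT.
  apply: (@le0_geometric _ _ (2 * (c * expR (2 * K * `|0|)))) => k.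
  by rewrite -{1}(picard_iterate0 k); exact: phiP.
split=> // i a b ab; apply/eqP.
rewrite -subr_eq0 -normr_eq0 eq_le normr_ge0 andbT.
pose T := Num.max `|a| `|b|; pose C := 2 * (c * expR (2 * K * T)).
have C0 : 0 <= C by rewrite mulr_ge0// mulr_ge0// expR_ge0.
apply: (@le0_geometric _ _ (2 * C + K * C * (b - a))) => k.
have [ck pk] := picard_iterate_prop k.
set I := \int[_]_(s in _) _.
have -> : phi b i 0 - phi a i 0 - I =
    (phi b - picard_iterate k.+1 b) i 0 - (phi a - picard_iterate k.+1 a) i 0 +
    (picard_iterate k.+1 b i 0 - picard_iterate k.+1 a i 0 - I).
  by rewrite !mxE; ring.
have rest t : `|t| <= T ->
    `|(phi t - picard_iterate k.+1 t) i 0| <= C * 2^-1 ^+ k.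
  move=> tT; apply: le_trans (cV_norm_ge _ _) _.
  apply: le_trans (unif T k.+1 t tT) _; rewrite -/C ler_wpM2l// exprS.
  by rewrite ler_piMl ?exprn_ge0 ?invr_ge0//; lra.
have bT : `|b| <= T by rewrite le_max lexx orbT.
have aT : `|a| <= T by rewrite le_max lexx.
apply: le_trans (ler_normD _ _) _.
apply: le_trans (lerD (ler_normB _ _) (lexx _)) _.
suff H : `|picard_iterate k.+1 b i 0 - picard_iterate k.+1 a i 0 - I| <=
    K * (C * 2^-1 ^+ k) * b - K * (C * 2^-1 ^+ k) * a.
  have := lerD (lerD (rest b bT) (rest a aT)) H.
  by congr (_ <= _); ring.
have bphi := fm phi cphi i.
rewrite /I -(primitive_signed_integral bphi)//.
have pd := primitiveB (fm _ ck i) bphi (pk i) (primitive_signed_integral bphi).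
have := primitive_bound ab _ (locbdd_meas_cst _) pd (primitive_cst _).
move=> /(_ (K * (C * 2^-1 ^+ k)) (locbdd_measB (fm _ ck i) bphi)) H.
apply: le_trans (H _).
  by rewrite le_eqVlt; apply/orP; left; apply/eqP; congr `|_|; ring.
move=> s /andP[sa sb].
have -> : f s (picard_iterate k s) i 0 - f s (phi s) i 0 =
    (f s (picard_iterate k s) - f s (phi s)) i 0 by rewrite !mxE.
apply: le_trans (cV_norm_ge _ _) _; apply: le_trans (flip _ _ _) _.
rewrite ler_wpM2l ?(ltW K0)// distrC; apply: unif.
rewrite le_max; have [s0|s0] := leP 0 s.
  by rewrite [`|b|]ger0_norm ?(le_trans s0)// ger0_norm// sb orbT.
by rewrite [`|a|]ltr0_norm ?(le_lt_trans sa)// ltr0_norm// lerN2 sa.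
Qed.

End Picard.
End Caratheodory.

(** * Bounded controls and their trajectories *)

(** Makes the filter lemmas find the almost-everywhere filter on [R]. *)
#[local] Instance ae_lebesgue_filter (R : realType) :
  Filter (nbhs (almost_everywhere (@lebesgue_measure R))).
Proof. exact: ae_filter_ringOfSetsType. Qed.

Section Controls.
Context {R : realType} {n m : nat}.
Local Notation mu := (@lebesgue_measure R).
Implicit Types (S : affine_system R n m) (u : R -> 'cV[R]_m).
Implicit Types (phi : R -> 'cV[R]_n) (x y : 'cV[R]_n) (c t : R).

Lemma mulmx_norm_le p q (A : 'M[R]_(p, q)) (v : 'cV[R]_q) :
  `|A *m v| <= q%:R * `|A| * `|v|.
Proof.
apply: cV_norm_le => [|i]; first by rewrite !mulr_ge0.
rewrite mxE (le_trans (ler_norm_sum _ _ _))//.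
have -> : q%:R * `|A| * `|v| = \sum_(j < q) `|A| * `|v|.
  by rewrite sumr_const card_ord -mulrA mulr_natl.
apply: ler_sum => j _; rewrite normrM ler_pM//; last exact: cV_norm_ge.
by rewrite [leRHS]/Num.norm/= mx_normrE; apply/bigmax_geP; right; exists (i, j).
Qed.

(** The coordinates of the vector field along a curve are polynomials in those
    of the control and of the curve.  Stated for any class [P] closed under
    these operations, this serves for measurability alone and for
    [locbdd_meas]. *)
Section VectorFieldClosure.
Variable P : (R -> R) -> Prop.
Hypothesis P_cst : forall c, P (fun=> c).
Hypothesis P_add : forall f g, P f -> P g -> P (fun s => f s + g s).
Hypothesis P_mul : forall f g, P f -> P g -> P (fun s => f s * g s).

Lemma vfield_coord_closed S u phi i :
  (forall k, P (fun s => u s k 0)) -> (forall j, P (fun s => phi s j 0)) ->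
  P (fun s => vfield S (u s) (phi s) i 0).
Proof.
move=> Pu Pphi.
have P_sum (I : finType) (F : I -> R -> R) :
    (forall j, P (F j)) -> P (fun s => \sum_j F j s).
  move=> PF; elim: index_enum => [|j r ih].
    under eq_fun do rewrite big_nil.
    exact: P_cst.
  under eq_fun do rewrite big_cons.
  exact: P_add.
rewrite /vfield; under eq_fun do rewrite !mxE.
apply: P_add (P_cst _); apply: P_add.
  apply: (P_sum) => j; apply: P_mul => //.
  under eq_fun do rewrite mxE summxE.
  apply: P_add (P_cst _) _; apply: (P_sum) => k.
  under eq_fun do rewrite mxE.
  exact: P_mul (Pu k) (P_cst _).
by apply: (P_sum) => j; apply: P_mul (P_cst _) (Pu j).
Qed.

End VectorFieldClosure.

Lemma vfield_sub S v x y : vfield S v x - vfield S v y = Amx S v *m (x - y).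
Proof.
rewrite /vfield mulmxBr opprD addrACA subrr addr0.
by rewrite opprD addrACA subrr addr0.
Qed.

Lemma Amx_bound S (U : R) : exists2 K, 0 < K & forall v x, `|v| <= U ->
  `|Amx S v *m x| <= K * `|x|.
Proof.
pose K0 := n%:R * (`|sysA S| + \sum_(k < m) `|U| * `|sysB S k|).
have s0 : 0 <= \sum_(k < m) `|U| * `|sysB S k|.
  by apply: sumr_ge0 => k _; rewrite mulr_ge0.
exists (K0 + 1); first by rewrite ltr_wpDl// mulr_ge0// addr_ge0.
move=> v x vU; apply: le_trans (mulmx_norm_le _ _) _.
rewrite ler_wpM2r//; apply: (@le_trans _ _ K0); last by rewrite lerDl.
rewrite ler_wpM2l//; apply: le_trans (ler_normD _ _) _; rewrite lerD2l.
apply: le_trans (ler_norm_sum _ _ _) _; apply: ler_sum => k _.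
rewrite normrZ ler_wpM2r//; apply: le_trans (cV_norm_ge v k) _.
by apply: le_trans vU _; exact: ler_norm.
Qed.

(** Everywhere bounded representatives of the controls: with them the vector
    field satisfies [caratheodory], with no exceptional null set. *)
Definition bounded_control S u : Prop :=
  [/\ forall k, measurable_fun [set: R] (fun t => u t k 0),
      exists U, forall t, `|u t| <= U &
      {ae mu, forall t, sysOmega S (u t)}].

Lemma bounded_control_locbdd S u k :
  bounded_control S u -> locbdd_meas (fun t => u t k 0).
Proof.
move=> [mu' [U uU] _]; split=> // T; exists U => t _.
exact: le_trans (cV_norm_ge _ k) (uU t).
Qed.

Lemma vfield_locbdd S u phi :
  bounded_control S u -> continuous phi ->
  cV_locbdd_meas (fun s => vfield S (u s) (phi s)).
Proof.
move=> bu cphi i; apply: vfield_coord_closed.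
- exact: locbdd_meas_cst.
- exact: locbdd_measD.
- exact: locbdd_measM.
- by move=> k; exact: bounded_control_locbdd bu.
- by move=> j; apply/locbdd_meas_continuous/cV_coord_continuous.
Qed.

Lemma vfield_caratheodory S u : bounded_control S u ->
  exists K, caratheodory (fun s => vfield S (u s)) K.
Proof.
move=> bu; have [_ [U uU] _] := bu; have [K K0 SK] := Amx_bound S U.
exists K; split=> // [phi|s x y|x].
- exact: vfield_locbdd.
- by rewrite vfield_sub; exact: SK.
- exists (K * `|x| + m%:R * `|sysC S| * `|U| + `|sysd S|) => s.
  apply: le_trans (ler_normD _ _) _; rewrite lerD2r.
  apply: le_trans (ler_normD _ _) _; apply: lerD; first exact: SK.
  apply: le_trans (mulmx_norm_le _ _) _; rewrite ler_wpM2l ?mulr_ge0//.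
  by apply: le_trans (uU s) _; exact: ler_norm.
Qed.

Lemma solutionE S u x phi :
  solution S u x phi <->
  ode_solution (fun s => vfield S (u s)) phi /\ phi 0 = x.
Proof.
split=> [[cphi phi0 pphi]|[[cphi pphi] phi0]].
  by split=> //; split=> // i a b ab; exact: pphi.
by split=> // a b ab i; exact: pphi.
Qed.

Lemma bounded_control_control S u : bounded_control S u -> control S u.
Proof.
move=> [mu_u [U uU] uO]; split=> // k.
rewrite inE; apply/andP; split; first by rewrite inE; exact: mu_u.
rewrite inE/= /finite_norm unlock/=.
case: ifP => // _; apply: (@le_lt_trans _ _ U%:E); last exact: ltry.
apply: ess_sup_ler => t /=.
by rewrite lee_fin; apply: le_trans (cV_norm_ge _ k) (uU t).
Qed.

Lemma control_essentially_bounded S u k : control S u ->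
  exists M, {ae mu, forall t, `|u t k 0| <= M}.
Proof.
move=> [Lu _]; have /andP[_] := Lu k; rewrite inE/= /finite_norm unlock/=.
have -> : (0 < mu [set: R])%E.
  by rewrite -set_itvNyy lebesgue_measure_itv/= ltry.
by move=> /ess_supr_bounded.
Qed.

(** Truncating an essentially bounded control at its essential bound changes
    it on a null set only, which no integral sees. *)
Lemma control_normalization S u : control S u ->
  exists2 w, bounded_control S w &
    forall x phi, solution S u x phi -> solution S w x phi.
Proof.
move=> cu; have /choice[M MP] := fun k => control_essentially_bounded k cu.
have mes k : measurable_fun [set: R] (fun t => u t k 0).
  by have /andP[] := cu.1 k; rewrite inE.
pose w t : 'cV[R]_m := \col_k Num.max (- `|M k|) (Num.min `|M k| (u t k 0)).
have uw : {ae mu, forall t, u t = w t}.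
  have : {ae mu, forall t, forall k, `|u t k 0| <= M k}.
    exact: (@filter_forall _ _ (fun k t => `|u t k 0| <= M k) _ _ MP).
  apply: filterS => t ut; apply/matrixP => k j; rewrite ord1 mxE.
  have := le_trans (ut k) (ler_norm _); rewrite ler_norml => /andP[h1 h2].
  by rewrite min_r// max_r.
have mw k : measurable_fun [set: R] (fun t => w t k 0).
  under eq_fun do rewrite mxE.
  apply: measurable_maxr; first exact: measurable_cst.
  by apply: measurable_minr => //; exact: measurable_cst.
have bw : bounded_control S w.
  split=> //.
    exists (\sum_k `|M k|) => t; apply: cV_norm_le => [|k].
      exact: sumr_ge0.
    rewrite mxE; apply: (@le_trans _ _ `|M k|).
      rewrite ler_norml le_max lexx/= ge_max ge_min lexx/= andbT.
      by have := normr_ge0 (M k); lra.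
    by rewrite (bigD1 k)//= lerDl sumr_ge0.
  by apply: filterS2 uw cu.2 => t ->.
exists w => // x phi [cphi phi0 pphi]; split=> // a b ab i.
rewrite pphi// /Rintegral; congr fine.
have mphi j : measurable_fun [set: R] (fun s => phi s j 0).
  by have [] := locbdd_meas_continuous (@cV_coord_continuous _ _ _ j cphi).
have mv (w' : R -> 'cV[R]_m) :
    (forall k, measurable_fun [set: R] (fun t => w' t k 0)) ->
    measurable_fun [set: R] (fun s => vfield S (w' s) (phi s) i 0).
  move=> mw'; apply: vfield_coord_closed => //.
  - by move=> f g; exact: measurable_funD.
  - by move=> f g; exact: measurable_funM.
apply: ae_eq_integral => //.
- by apply/measurable_EFinP; apply: measurable_funS (mv u mes).
- by apply/measurable_EFinP; apply: measurable_funS (mv w mw).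
- by apply: filterS uw => s us _ /=; rewrite us.
Qed.

End Controls.

(** * Time reversal, shift and concatenation *)

Section TimeReversal.
Context {R : realType} {n m : nat}.
Local Notation mu := (@lebesgue_measure R).
Implicit Types (S : affine_system R n m) (u : R -> 'cV[R]_m).
Implicit Types (phi : R -> 'cV[R]_n) (x y : 'cV[R]_n) (c t : R).

(** The system whose trajectories are those of [S] run backwards in time. *)
Definition reverse_system S : affine_system R n m :=
  AffineSystem (- sysA S) (fun i => - sysB S i) (- sysC S) (- sysd S)
    (sysOmega S).

Lemma reverse_systemK : involutive reverse_system.
Proof.
case=> A B C d O; rewrite /reverse_system/= !opprK; congr AffineSystem.
by apply/funext => i; rewrite opprK.
Qed.

Lemma Amx_reverse S v : Amx (reverse_system S) v = - Amx S v.
Proof.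
rewrite /Amx/= opprD -sumrN; congr (_ + _).
by apply: eq_bigr => i _; rewrite scalerN.
Qed.

Lemma vfield_reverse S v x : vfield (reverse_system S) v x = - vfield S v x.
Proof. by rewrite /vfield Amx_reverse !mulNmx !opprD. Qed.

Lemma bounded_control_reflect S u c : bounded_control S u ->
  bounded_control (reverse_system S) (fun t => u (c - t)).
Proof.
move=> [mes [U uU] [N [mN N0 uN]]]; split.
- move=> k; apply: (measurableT_comp (mes k)).
  by apply: measurable_funB => //; exact: measurable_cst.
- by exists U.
- exists (reflection c @^-1` N); split.
  + rewrite -[_ @^-1` _]setTI; apply: measurable_reflection => //.
  + by have := lebesgue_measure_reflection c mN; rewrite N0.
  + by move=> t /= ut; apply: uN.
Qed.

Lemma ode_solution_reflect S u phi c : bounded_control S u ->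
  ode_solution (fun s => vfield S (u s)) phi ->
  ode_solution (fun s => vfield (reverse_system S) (u (c - s)))
    (fun t => phi (c - t)).
Proof.
move=> bu [cphi pphi]; split.
  move=> t; apply: (@continuous_comp _ _ _ (fun t : R => c - t) phi).
    by apply: cvgB; [exact: cvg_cst|exact: cvg_id].
  exact: cphi.
move=> i; have := primitive_reflect c (vfield_locbdd bu cphi i) (pphi i).
congr primitive; apply/funext => s.
by rewrite vfield_reverse [RHS]mxE.
Qed.

(** A shift is the product of the reflections about [0] and [- c]; reversing
    the system twice restores it. *)
Lemma bounded_control_shift S u c : bounded_control S u ->
  bounded_control S (fun t => u (t + c)).
Proof.
move=> /(@bounded_control_reflect _ _ 0) /(@bounded_control_reflect _ _ (- c)).
by rewrite reverse_systemK; under eq_fun do rewrite sub0r opprB opprK.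
Qed.

Lemma ode_solution_shift S u phi c : bounded_control S u ->
  ode_solution (fun s => vfield S (u s)) phi ->
  ode_solution (fun s => vfield S (u (s + c))) (fun t => phi (t + c)).
Proof.
move=> bu /(ode_solution_reflect 0 bu).
move=> /(ode_solution_reflect (- c) (bounded_control_reflect 0 bu)).
have e t : 0 - (- c - t) = t + c by ring.
by rewrite reverse_systemK; under eq_fun do rewrite e;
  under [X in ode_solution _ X]eq_fun do rewrite e.
Qed.

Lemma bounded_control_glue S u1 u2 c : bounded_control S u1 ->
  bounded_control S u2 ->
  bounded_control S (fun t => if t <= c then u1 t else u2 t).
Proof.
move=> [m1 [U1 b1] o1] [m2 [U2 b2] o2]; split.
- move=> k; under eq_fun do rewrite (fun_if (fun v : 'cV_m => v k 0)).
  apply: measurable_fun_ifT => //.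
  by apply: measurable_fun_ler => //; exact: measurable_cst.
- exists (Num.max U1 U2) => t; rewrite le_max.
  by case: ifP => _; rewrite ?b1 ?b2 ?orbT.
- by apply: filterS2 o1 o2 => t o1 o2; case: ifP.
Qed.

(** Continuity of the glued curve comes for free: it is a primitive of the
    glued integrand. *)
Lemma ode_solution_glue S u1 u2 phi1 phi2 c : bounded_control S u1 ->
  bounded_control S u2 ->
  ode_solution (fun s => vfield S (u1 s)) phi1 ->
  ode_solution (fun s => vfield S (u2 s)) phi2 -> phi1 c = phi2 c ->
  ode_solution (fun s => vfield S (if s <= c then u1 s else u2 s))
    (fun t => if t <= c then phi1 t else phi2 t).
Proof.
move=> b1 b2 [c1 p1] [c2 p2] phic.
pose g s := if s <= c then vfield S (u1 s) (phi1 s)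
            else vfield S (u2 s) (phi2 s).
pose phi t := if t <= c then phi1 t else phi2 t.
have bg : cV_locbdd_meas g.
  move=> i; rewrite /g.
  under eq_fun do rewrite (fun_if (fun v : 'cV_n => v i 0)).
  by apply: locbdd_meas_glue; exact: vfield_locbdd.
have pg : cV_primitive g phi.
  move=> i; rewrite /g /phi.
  have -> : (fun s => (if s <= c then vfield S (u1 s) (phi1 s)
      else vfield S (u2 s) (phi2 s)) i 0) = (fun s => if s <= c then
      vfield S (u1 s) (phi1 s) i 0 else vfield S (u2 s) (phi2 s) i 0).
    by apply/funext => s; case: ifP.
  have -> : (fun t => (if t <= c then phi1 t else phi2 t) i 0) =
      (fun t => if t <= c then phi1 t i 0 else phi2 t i 0).
    by apply/funext => s; case: ifP.
  apply: primitive_glue => //; [exact: vfield_locbdd|exact: vfield_locbdd|].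
  by rewrite phic.
split; first exact: cV_primitive_continuous pg.
have -> : (fun s => vfield S (if s <= c then u1 s else u2 s)
    (if s <= c then phi1 s else phi2 s)) = g; last exact: pg.
by apply/funext => s; rewrite /g; case: ifP.
Qed.

End TimeReversal.

(** * Orbits *)

Section Orbits.
Context {R : realType} {n m : nat}.
Implicit Types (S : affine_system R n m) (u : R -> 'cV[R]_m).
Implicit Types (phi : R -> 'cV[R]_n) (x y z : 'cV[R]_n) (c t : R).

Lemma orbit_posP S x y : orbit_pos S x y <-> exists t u phi,
  [/\ 0 <= t, bounded_control S u,
      ode_solution (fun s => vfield S (u s)) phi, phi 0 = x & phi t = y].
Proof.
split=> [[t [u [phi [t0 cu su phit]]]]|[t [u [phi [t0 bu su phi0 phit]]]]].
  have [w bw uw] := control_normalization cu.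
  by exists t, w, phi; have /solutionE[] := uw _ _ su.
exists t, u, phi; split=> //; first exact: bounded_control_control.
exact/solutionE.
Qed.

Lemma orbit_pos_reverse S x y :
  orbit_pos S x y -> orbit_pos (reverse_system S) y x.
Proof.
move=> /orbit_posP[t [u [phi [t0 bu su phi0 phit]]]]; apply/orbit_posP.
exists t, (fun s => u (t - s)), (fun s => phi (t - s)); split=> //.
- exact: bounded_control_reflect.
- exact: ode_solution_reflect.
- by rewrite subr0.
- by rewrite subrr.
Qed.

Lemma orbit_neg_reverse S x : orbit_neg S x = orbit_pos (reverse_system S) x.
Proof.
apply/seteqP; split=> y; first exact: orbit_pos_reverse.
by move=> /orbit_pos_reverse; rewrite reverse_systemK.
Qed.

Lemma orbit_pos_segment S u phi s t : bounded_control S u ->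
  ode_solution (fun s => vfield S (u s)) phi -> s <= t ->
  orbit_pos S (phi s) (phi t).
Proof.
move=> bu su st; apply/orbit_posP.
exists (t - s), (fun r => u (r + s)), (fun r => phi (r + s)); split.
- by rewrite subr_ge0.
- exact: bounded_control_shift.
- exact: ode_solution_shift.
- by rewrite add0r.
- by rewrite subrK.
Qed.

Lemma orbit_pos_trans S x y z :
  orbit_pos S x y -> orbit_pos S y z -> orbit_pos S x z.
Proof.
move=> /orbit_posP[t1 [u1 [phi1 [t10 b1 s1 phi10 phi1t]]]].
move=> /orbit_posP[t2 [u2 [phi2 [t20 b2 s2 phi20 phi2t]]]].
apply/orbit_posP; exists (t1 + t2).
exists (fun t => if t <= t1 then u1 t else u2 (t - t1)).
exists (fun t => if t <= t1 then phi1 t else phi2 (t - t1)); split.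
- exact: addr_ge0.
- by apply: bounded_control_glue => //; exact: bounded_control_shift.
- apply: ode_solution_glue => //.
  + exact: bounded_control_shift.
  + exact: ode_solution_shift.
  + by rewrite subrr phi1t phi20.
- by rewrite t10.
- case: ifP => [|_]; last by rewrite addrC addKr.
  rewrite gerDl => t2le; have t2E : t2 = 0 by apply/le_anti; rewrite t2le.
  by rewrite t2E addr0 phi1t -phi20 -phi2t t2E.
Qed.

(** Solutions for one control separate at most exponentially, by [gronwall]
    applied to their difference. *)
Lemma ode_solution_continuous_dependence S u phi t (e : R) :
  bounded_control S u -> ode_solution (fun s => vfield S (u s)) phi ->
  0 < e -> exists2 d, 0 < d & forall y, `|phi 0 - y| <= d ->
    exists2 psi, ode_solution (fun s => vfield S (u s)) psi &
      psi 0 = y /\ `|phi t - psi t| <= e.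
Proof.
move=> bu [cphi pphi] e0; have [K fK] := vfield_caratheodory bu.
have [K0 _ flip _] := fK; pose E := expR (2 * K * `|t|).
have E0 : 0 < E by exact: expR_gt0.
exists (e / (2 * E)) => [|y yd]; first by rewrite divr_gt0// mulr_gt0.
have [psi [cpsi ppsi] psi0] := picard_lindelof y fK.
exists psi => //; split=> //.
have bphi := vfield_locbdd bu cphi; have bpsi := vfield_locbdd bu cpsi.
have H := gronwall K0 (lexx 0) (cV_locbdd_measB bphi bpsi)
  (cV_primitiveB bphi bpsi pphi ppsi) _ (lexx `|t|).
apply: le_trans (H _) _; first by move=> s _; rewrite addr0; exact: flip.
rewrite psi0 mul0r addr0 -/E; apply: le_trans (_ : 2 * (e / (2 * E)) * E <= e).
  by rewrite ler_wpM2r ?(ltW E0)// ler_wpM2l.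
by rewrite le_eqVlt; apply/orP; left; apply/eqP; field; rewrite gt_eqF.
Qed.

(** A point close to [phi 0] in the orbit of [x0] can follow the same control
    and ends close to [phi t]. *)
Lemma closure_orbit_pos_invariant S x0 u phi t : bounded_control S u ->
  ode_solution (fun s => vfield S (u s)) phi -> 0 <= t ->
  closure (orbit_pos S x0) (phi 0) -> closure (orbit_pos S x0) (phi t).
Proof.
move=> bu su t0 cl B /nbhs_ballP[e /= e0 eB].
have e20 : 0 < e / 2 by rewrite divr_gt0.
have [d d0 dP] := ode_solution_continuous_dependence t bu su e20.
have [y [oy yd]] := cl _ (nbhsx_ballx (phi 0) d d0).
move: yd; rewrite -ball_normE/= => /ltW /dP[psi spsi [psi0 psit]].
exists (psi t); split.
  apply: orbit_pos_trans oy _; rewrite -psi0.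
  exact: orbit_pos_segment spsi t0.
by apply: eB; rewrite -ball_normE/=; apply: le_lt_trans psit _; lra.
Qed.

Lemma closure_orbit_pos_trans S x y z : orbit_pos S x y ->
  closure (orbit_pos S y) z -> closure (orbit_pos S x) z.
Proof.
by move=> xy; apply: closure_subset => w; exact: orbit_pos_trans.
Qed.

End Orbits.

(** * Control sets from two-way local controllability *)

Section ControlSets.
Context {R : realType} {n m : nat}.
Implicit Types (S : affine_system R n m) (u : R -> 'cV[R]_m).
Implicit Types (phi : R -> 'cV[R]_n) (x y z : 'cV[R]_n).

Lemma equilibrium_ode_solution S v x : equilibrium S v x ->
  ode_solution (fun s => vfield S v) (fun=> x).
Proof.
move=> vx; split; first exact: cst_continuous.
move=> i a b ab; rewrite vx mxE subrr Rintegral_cst//; exact/esym/mul0r.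
Qed.

Lemma constant_bounded_control S v : sysOmega S v ->
  bounded_control S (fun=> v).
Proof.
move=> Ov; split=> [k||]; first exact: measurable_cst.
- by exists `|v|.
- exact: nearW.
Qed.

Definition mutually_reachable S x : set 'cV[R]_n :=
  orbit_pos S x `&` orbit_neg S x.

Lemma mutually_reachable_sym S x y :
  mutually_reachable S x y -> mutually_reachable S y x.
Proof. by case. Qed.

Lemma mutually_reachable_trans S x y z : mutually_reachable S x y ->
  mutually_reachable S y z -> mutually_reachable S x z.
Proof.
move=> [xy yx] [yz zy]; split; first exact: orbit_pos_trans xy yz.
exact: orbit_pos_trans zy yx.
Qed.

(** The points of the path mutually reachable with [x] form a relatively open
    set by hypothesis, and a relatively closed one since a point in the closure
    of the class has a neighbourhood of points equivalent to it.  The image of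
    a path being connected, the class contains the end point. *)
Lemma mutually_reachable_pathwise_connected S (C : set 'cV[R]_n) x y :
  pathwise_connected R C ->
  (forall z, C z -> nbhs z (mutually_reachable S z)) ->
  C x -> C y -> mutually_reachable S x y.
Proof.
move=> [_ pC] loc Cx Cy; have [g [cg g0 g1 gC]] := pC x y Cx Cy.
have cI : connected (g @` `[0, 1]).
  exact: connected_continuous_connected (@segment_connected _ _ _) cg.
pose I := g @` `[0, 1].
have Ix : I x by exists 0 => //=; rewrite in_itv/= lexx ler01.
have Iy : I y by exists 1 => //=; rewrite in_itv/= lexx ler01.
suff BI : I `&` mutually_reachable S x = I by have := Iy; rewrite -BI => -[].
apply: cI.
- by exists x; split=> //; exact: nbhs_singleton (loc _ Cx).
- exists (interior (mutually_reachable S x)); first exact: open_interior.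
  apply/seteqP; split=> [z [Iz xz]|z [Iz]]; split=> //.
    apply: filterS (loc z (gC _ Iz)) => w; exact: mutually_reachable_trans.
  exact: interior_subset.
- exists (closure (I `&` mutually_reachable S x)); first exact: closed_closure.
  apply/seteqP; split=> [z [Iz xz]|z [Iz clz]]; split=> //.
    by apply: subset_closure.
  have [w [[_ xw] zw]] := clz _ (loc z (gC _ Iz)).
  exact: mutually_reachable_trans xw (mutually_reachable_sym zw).
Qed.

Definition control_set_of S x : set 'cV[R]_n :=
  orbit_neg S x `&` closure (orbit_pos S x).

Lemma control_set_of_mutually_reachable S x y :
  mutually_reachable S x y -> control_set_of S x `<=` control_set_of S y.
Proof.
move=> [xy yx] z [zx xz]; split; first exact: orbit_pos_trans zx xy.
exact: closure_orbit_pos_trans yx xz.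
Qed.

(** Steer to the equilibrium [x] and keep the constant control [v]. *)
Lemma control_set_of_viable S v x : sysOmega S v -> equilibrium S v x ->
  viable S (control_set_of S x).
Proof.
move=> Ov vx y [/orbit_posP[t [u [phi [t0 bu su phi0 phit]]]] xy].
pose w s := if s <= t then u s else v.
pose psi s := if s <= t then phi s else x.
have bw : bounded_control S w.
  exact: bounded_control_glue bu (constant_bounded_control Ov).
have spsi : ode_solution (fun s => vfield S (w s)) psi.
  by apply: ode_solution_glue bu (constant_bounded_control Ov) su _ phit;
    exact: equilibrium_ode_solution.
have psi0 : psi 0 = y by rewrite /psi t0.
exists w, psi; split=> [||s s0].
- exact: bounded_control_control.
- exact/solutionE.
- split.
    have -> : x = psi (Num.max s t).
      rewrite /psi; case: ifP => // st; rewrite -phit; congr phi.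
      by apply/le_anti; rewrite st le_max lexx orbT.
    by apply: orbit_pos_segment bw spsi _; rewrite le_max lexx.
  by apply: closure_orbit_pos_invariant bw spsi s0 _; rewrite psi0.
Qed.

Lemma control_set_of_approx_controllable S x :
  approx_controllable S (control_set_of S x).
Proof. by move=> y [yx _] z [_ xz]; exact: closure_orbit_pos_trans yx xz. Qed.

(** Maximality: a point [y] of a larger approximately controllable set reaches
    points arbitrarily close to [x], in particular one of the neighbourhood of
    [x] from which [x] can be reached. *)
Lemma control_set_of_control_set S v x : sysOmega S v -> equilibrium S v x ->
  nbhs x (mutually_reachable S x) -> control_set S (control_set_of S x).
Proof.
move=> Ov vx loc; have [xx _] := nbhs_singleton loc.
have Dx : control_set_of S x x by split=> //; exact: subset_closure.
split; first by exists x.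
- exact: control_set_of_viable vx.
- exact: control_set_of_approx_controllable.
- move=> E DE _ aE; apply/seteqP; split=> // y Ey.
  split; last exact: aE (DE _ Dx) _ Ey.
  have [w [yw [_ wx]]] := aE y Ey x (DE _ Dx) _ loc.
  exact: orbit_pos_trans yw wx.
Qed.

End ControlSets.

(** * Steering a linear system along polynomials *)

Section FlatTrajectories.
Context {R : realType}.
Local Notation "v ^P" := (map_mx polyC v) (at level 2, format "v ^P").

Section Flat.
Variables (a : nat -> R) (xi : {poly R}).

(** The coordinates of a linear system with input matrix a single column are
    obtained from the free polynomial [xi], its flat output, by applying to it
    the Horner truncations of the differential operator with coefficients
    [a]. *)
Fixpoint flat (j : nat) : {poly R} :=
  if j is j'.+1 then (flat j')^`() + (a j')%:P * xi else xi.

(** Each step lowers the order of vanishing at [c] by at most one, and the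
    leading term is multiplied by the current exponent; the term in [a] does
    not reach the leading order. *)
Lemma flat_factor (c : R) N q0 j : xi = ('X - c%:P) ^+ N * q0 -> (j <= N)%N ->
  exists2 q, flat j = ('X - c%:P) ^+ (N - j) * q &
    q.[c] = (N ^_ j)%:R * q0.[c].
Proof.
move=> xiE; elim: j => [|j ih] jN.
  by exists q0; [rewrite subn0|rewrite ffactn0 mul1r].
have [q fq qc] := ih (ltnW jN).
exists ((N - j)%:R *: q + ('X - c%:P) * q^`() +
        (a j)%:P * ('X - c%:P) ^+ j.+1 * q0); last first.
  rewrite !hornerE subrr mul0r addr0 expr0n/= mulr0 mul0r addr0 qc.
  by rewrite ffactnSr natrM; ring.
rewrite /= fq derivM deriv_exp derivXsubC mul1r.
have NjE : (N - j = (N - j.+1).+1)%N by rewrite -subnSK.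
have -> : xi = ('X - c%:P) ^+ (N - j.+1) * (('X - c%:P) ^+ j.+1 * q0).
  by rewrite xiE mulrA -exprD subnK.
rewrite NjE /= (exprS _ (N - j.+1)) scaler_nat mulrnAl !mulrDr mulrnAr.
congr (_ + _ + _); first by rewrite mulrCA mulrA.
by rewrite !mulrA [_ * (_ ^+ (N - j.+1))]mulrC.
Qed.

End Flat.

Section SingleInput.
Variables (n' : nat).
Let n := n'.+1.
Variables (A : 'M[R]_n) (b : 'cV[R]_n) (xi : {poly R}).

Let chi k : R := (char_poly A)`_k.
Let fl := flat (fun j => chi (n' - j)) xi.
Let v k : 'cV[R]_n := A ^+ k *m b.

(** The trajectory is (chi(A) - chi(D)) / (A - D) applied to [xi b], for chi
    the characteristic polynomial and D the differentiation: multiplied by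
    D - A it gives chi(D) [xi b] - chi(A) [xi b], whose second term vanishes by
    the Cayley-Hamilton theorem.  The input is thus chi(D) [xi]. *)
Definition flat_state : 'cV[{poly R}]_n :=
  \sum_(k < n) fl (n' - k) *: (v k)^P.
Definition flat_input : {poly R} := fl n.

Lemma char_poly_orbit : \sum_(k < n.+1) chi k *: v k = 0.
Proof.
have := Cayley_Hamilton A; rewrite -{1}[char_poly A]coefK poly_def.
rewrite rmorph_sum/= size_char_poly => /(congr1 (mulmx^~ b))/=.
rewrite mul0mx mulmx_suml => H; rewrite -[RHS]H; apply: eq_bigr => k _.
by rewrite horner_mxZ rmorphXn/= horner_mx_X scalemxAl.
Qed.

Lemma map_mx_deriv_scale p k (w : 'M[R]_(k, 1)) :
  map_mx (deriv (R:=R)) (p *: w^P) = p^`() *: w^P.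
Proof. by apply/matrixP => i j; rewrite !mxE derivM derivC mulr0 addr0. Qed.

Lemma flat_state_deriv :
  map_mx (deriv (R:=R)) flat_state = A^P *m flat_state + flat_input *: b^P.
Proof.
rewrite /flat_state raddf_sum/= mulmx_sumr.
have -> : \sum_(k < n) map_mx (deriv (R:=R)) (fl (n' - k) *: (v k)^P) =
  \sum_(k < n) fl (n - k) *: (v k)^P - xi *: (\sum_(k < n) chi k *: v k)^P.
  rewrite raddf_sum/= scaler_sumr -sumrB; apply: eq_bigr => k _.
  rewrite map_mx_deriv_scale subSn ?leq_ord// /fl/= subKn ?leq_ord//.
  rewrite map_mxZ/= scalerA scalerDl mulrC addrK//.
have -> : \sum_(k < n) A^P *m (fl (n' - k) *: (v k)^P) =
  \sum_(k < n) fl (n' - k) *: (v k.+1)^P.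
  apply: eq_bigr => k _.
  by rewrite -scalemxAr -map_mxM /v mulmxA exprS.
have := char_poly_orbit; rewrite big_ord_recr/=.
have -> : chi n = 1.
  have := char_poly_monic A; rewrite monicE lead_coefE size_char_poly => /eqP.
  by [].
rewrite scale1r => /(congr1 (fun w => w^P)); rewrite raddf0 raddfD/=.
move=> /(canRL (addrK _)) ->; rewrite sub0r scalerN opprK.
rewrite big_ord_recl/= [RHS]addrC [X in _ = _ + X]big_ord_recr/= subnn.
have -> : v 0 = b by rewrite /v expr0 mul1mx.
rewrite addrA; congr (_ + _ + _).
by rewrite /flat_input /fl/= subnn.
Qed.

End SingleInput.

Section PolynomialSteering.
Variables (n m : nat) (A : 'M[R]_n) (B : 'M[R]_(n, m)).

Definition polynomial_trajectory p (Z : 'M[{poly R}]_(n, p))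
    (W : 'M[{poly R}]_(m, p)) : Prop :=
  map_mx (deriv (R:=R)) Z = A^P *m Z + B^P *m W /\
  map_mx (horner_eval 0) Z = 0.

(** Polynomial trajectories allow to work over the ring [{poly R}], without
    solving any differential equation. *)
Definition steerable (zeta : 'cV[R]_n) : Prop :=
  exists Z W, polynomial_trajectory Z W /\ map_mx (horner_eval 1) Z = zeta.

Lemma steerable0 : steerable 0.
Proof.
by exists 0, 0; rewrite /polynomial_trajectory !raddf0 addr0.
Qed.

Lemma steerableD z1 z2 : steerable z1 -> steerable z2 -> steerable (z1 + z2).
Proof.
move=> [Z1 [W1 [[d1 i1] <-]]] [Z2 [W2 [[d2 i2] <-]]].
exists (Z1 + Z2), (W1 + W2); split; last by rewrite raddfD.
split; last by rewrite raddfD/= i1 i2 addr0.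
by rewrite raddfD/= d1 d2 !mulmxDr addrACA.
Qed.

Lemma steerableZ c z : steerable z -> steerable (c *: z).
Proof.
have E t (Z : 'cV[{poly R}]_n) : map_mx (horner_eval t) (c%:P *: Z) =
    c *: map_mx (horner_eval t) Z.
  by apply/matrixP => i j; rewrite !mxE /horner_eval hornerM hornerC.
move=> [Z [W [[d i] <-]]]; exists (c%:P *: Z), (c%:P *: W).
split; last exact: E.
split; last by rewrite E i scaler0.
rewrite -!scalemxAr -scalerDr -d; apply/matrixP => k j.
by rewrite !mxE derivM derivC mul0r add0r.
Qed.

Lemma steerable_sum (I : Type) (r : seq I) (z : I -> 'cV[R]_n) :
  (forall i, steerable (z i)) -> steerable (\sum_(i <- r) z i).
Proof.
move=> sz; elim: r => [|i r ih]; first by rewrite big_nil; exact: steerable0.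
by rewrite big_cons; exact: steerableD.
Qed.

End PolynomialSteering.

(** The flat output X^n (X - 1)^j with j = n - 1 - k vanishes at 0 to an order
    that makes the initial state 0.  At 1 its flat coordinates of index less
    than j vanish and the one of index j is j!.  The final state is therefore
    j! A^k b plus a combination of the A^l b with l < k, which are steerable by
    induction. *)
Lemma steerable_powers n' m (A : 'M[R]_n'.+1) (B : 'M[R]_(n'.+1, m)) i k :
  (k <= n')%N -> steerable A B (A ^+ k *m col i B).
Proof.
elim/ltn_ind: k => k ih kn.
pose j := (n' - k)%N.
pose xi : {poly R} := 'X ^+ n'.+1 * ('X - 1%:P) ^+ j.
pose b := col i B.
pose chi j := (char_poly A)`_(n' - j).
pose fl := flat chi xi.
have fl0 l : (l <= n')%N -> (fl l).[0] = 0.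
  move=> ln; have xi0 : xi = ('X - 0%:P) ^+ n'.+1 * ('X - 1%:P) ^+ j.
    by rewrite subr0.
  rewrite /fl; have [q -> _] := flat_factor chi xi0 (leqW ln).
  by rewrite subSn// hornerM horner_exp hornerXsubC subrr expr0n mul0r.
have xi1 : xi = ('X - 1%:P) ^+ j * 'X ^+ n'.+1 by rewrite mulrC.
have fl1 l : (l < j)%N -> (fl l).[1] = 0.
  move=> lj.
  rewrite /fl; have [q -> _] := flat_factor chi xi1 (ltnW lj).
  rewrite hornerM horner_exp hornerXsubC subrr expr0n.
  by rewrite subn_eq0 leqNgt lj mul0r.
have flj : (fl j).[1] = j`!%:R.
  rewrite /fl; have [q -> qc] := flat_factor chi xi1 (leqnn j).
  by rewrite subnn expr0 mul1r qc ffactnn hornerXn expr1n mulr1.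
pose zeta := \sum_(l < n'.+1) (fl (n' - l)%N).[1] *: (A ^+ l *m b).
have szeta : steerable A B zeta.
  have ev t : map_mx (horner_eval t) (flat_state A b xi) =
      \sum_(l < n'.+1) (fl (n' - l)%N).[t] *: (A ^+ l *m b).
    rewrite /flat_state raddf_sum/=; apply: eq_bigr => l _.
    move: (A ^+ l *m b) => w.
    by apply/matrixP => r c; rewrite !mxE /horner_eval hornerM hornerC.
  exists (flat_state A b xi), (flat_input A xi *: delta_mx i 0).
  split; last exact: ev.
  split.
    rewrite flat_state_deriv -scalemxAr; congr (_ + _ *: _).
    by rewrite -(map_delta_mx polyC) -map_mxM /b colE.
  rewrite ev big1// => l _; rewrite fl0 ?scale0r//; exact: leq_subr.
have kS : (k < n'.+1)%N by [].
have -> : A ^+ k *m b = (j`!%:R)^-1 *: (zeta -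
    \sum_(l < n'.+1 | l != Ordinal kS) (fl (n' - l)%N).[1] *: (A ^+ l *m b)).
  rewrite /zeta (bigD1 (Ordinal kS))//= addrK flj scalerA mulVf ?scale1r//.
apply: steerableZ; apply: steerableD => //.
rewrite -scaleN1r; apply: steerableZ; rewrite big_mkcond/=.
apply: steerable_sum => l; case: ifP => [lk|_]; last exact: steerable0.
have [kl|lk'] := ltnP k l.
  rewrite fl1 ?scale0r; first exact: steerable0.
  by rewrite /j ltn_sub2l// (leq_trans kl)// leq_ord.
apply: steerableZ; apply: ih; last exact: leq_ord.
by rewrite ltn_neqAle lk' andbT; apply: contra lk => /eqP e; apply/eqP/val_inj.
Qed.

Lemma steerable_kalman n m (A : 'M[R]_n) (B : 'M[R]_(n, m)) zeta :
  \rank (\mxrow_(k < n) (A ^+ k *m B)) = n -> steerable A B zeta.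
Proof.
case: n A B zeta => [|n'] A B zeta rk.
  have -> : zeta = 0 by apply/matrixP => -[].
  exact: steerable0.
have /row_freeP[K KP] : row_free (\mxrow_(k < n'.+1) (A ^+ k *m B)).
  by rewrite /row_free rk.
rewrite -[zeta]mul1mx -KP -mulmxA -[K *m zeta]submxcolK mul_mxrow_mxcol.
apply: steerable_sum => k; set eta := submxcol _ _.
have -> : A ^+ k *m B *m eta = \sum_(i < m) eta i 0 *: (A ^+ k *m col i B).
  rewrite -mulmxA [B *m eta](_ : _ = \sum_(i < m) eta i 0 *: col i B).
    by rewrite mulmx_sumr; apply: eq_bigr => i _; rewrite scalemxAr.
  apply/matrixP => r c; rewrite mxE summxE; apply: eq_bigr => i _.
  by rewrite !mxE ord1 mulrC.
apply: steerable_sum => i; apply: steerableZ.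
by apply: steerable_powers; exact: leq_ord.
Qed.

Lemma polynomial_steering n m (A : 'M[R]_n) (B : 'M[R]_(n, m)) :
  \rank (\mxrow_(k < n) (A ^+ k *m B)) = n ->
  exists (Z : 'M[{poly R}]_n) (W : 'M[{poly R}]_(m, n)),
    polynomial_trajectory A B Z W /\ map_mx (horner_eval 1) Z = 1%:M.
Proof.
move=> rk.
have /choice[ZW ZWP] : forall j, exists ZW : 'cV[{poly R}]_n * 'cV[{poly R}]_m,
    polynomial_trajectory A B ZW.1 ZW.2 /\
    map_mx (horner_eval 1) ZW.1 = delta_mx j 0.
  move=> j; have [Z [W P]] := steerable_kalman (delta_mx j 0) rk.
  by exists (Z, W).
exists (\matrix_(i, j) (ZW j).1 i 0), (\matrix_(i, j) (ZW j).2 i 0).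
split; first split.
- apply/matrixP => i j; have [[+ _] _] := ZWP j.
  move=> /matrixP/(_ i 0); rewrite !mxE => ->; congr (_ + _);
    by apply: eq_bigr => k _; rewrite !mxE.
- apply/matrixP => i j; have [[_ +] _] := ZWP j.
  by move=> /matrixP/(_ i 0); rewrite !mxE.
- apply/matrixP => i j; have [_ +] := ZWP j.
  by move=> /matrixP/(_ i 0); rewrite !mxE eqxx andbT.
Qed.

End FlatTrajectories.

(** * Local controllability at an equilibrium *)

Section PerturbedIdentity.
Context {R : realType} {n : nat}.

(** [F s = y] is the fixed point equation of the contraction
    [s |-> s - F s + y], which maps the ball of radius [rho] to itself. *)
Lemma perturbed_identity_onto (F : 'cV[R]_n -> 'cV[R]_n) (rho : R) : F 0 = 0 ->
  (forall s s', `|s| <= rho -> `|s'| <= rho ->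
     `|F s - F s' - (s - s')| <= 2^-1 * `|s - s'|) ->
  forall y, `|y| <= rho / 2 -> exists2 s, `|s| <= rho & F s = y.
Proof.
move=> F0 Flip y yr.
have rho0 : 0 <= rho by have := le_trans (normr_ge0 y) yr; lra.
pose G s := s - F s + y; pose sq k := iter k G 0.
have Gsub s s' : `|s| <= rho -> `|s'| <= rho ->
    `|G s - G s'| <= 2^-1 * `|s - s'|.
  move=> sr sr'; rewrite -normrN; apply: le_trans (Flip s s' sr sr').
  rewrite le_eqVlt; apply/orP; left; apply/eqP; congr `|_|.
  by apply/matrixP => i j; rewrite /G !mxE; ring.
have Gball s : `|s| <= rho -> `|G s| <= rho.
  move=> sr; have r0 : `|0 : 'cV[R]_n| <= rho by rewrite normr0.
  have := Gsub s 0 sr r0; rewrite subr0 {2}/G F0 subr0 add0r => h.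
  rewrite -[G s](subrK y); apply: le_trans (ler_normD _ _) _; lra.
have sqr k : `|sq k| <= rho.
  by elim: k => [|k ih]; rewrite /sq ?normr0//= Gball.
have step k : `|sq k.+1 - sq k| <= rho / 2 * 2^-1 ^+ k.
  elim: k => [|k ih]; first by rewrite /sq /= /G F0 !subr0 add0r expr0 mulr1.
  apply: le_trans (Gsub (sq k.+1) (sq k) _ _) _ => //.
  by rewrite exprS mulrCA ler_wpM2l// invr_ge0.
have [l lP] := cV_geometric_limit step.
have lr : `|l| <= rho.
  by have := lP 0%N; rewrite /sq/= subr0 expr0 mulr1; lra.
exists l => //; apply/eqP; rewrite -subr_eq0 -normr_eq0 eq_le normr_ge0 andbT.
apply: (@le0_geometric _ _ (2 * rho)) => k.
have -> : F l - y =
    (F l - F (sq k) - (l - sq k)) + (l - sq k) - (sq k.+1 - sq k).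
  by apply/matrixP => i j; rewrite /sq/= /G !mxE; ring.
apply: le_trans (ler_normB _ _) _.
apply: le_trans (lerD (ler_normD _ _) (lexx _)) _.
have := lP k; have := step k; have := Flip l (sq k) lr (sqr k).
have : 0 <= rho * 2^-1 ^+ k by rewrite mulr_ge0// exprn_ge0// invr_ge0.
lra.
Qed.

End PerturbedIdentity.

Section PolynomialCurves.
Context {R : realType}.

Lemma poly_mx_curveE p q (P : 'M[{poly R}]_(p, q)) (s : 'cV[R]_q) t i :
  (map_mx (horner_eval t) P *m s) i 0 = (\sum_j s j 0 *: P i j).[t].
Proof.
rewrite mxE horner_sum; apply: eq_bigr => j _.
by rewrite !mxE /horner_eval hornerZ mulrC.
Qed.

Lemma poly_mx_bound p q (P : 'M[{poly R}]_(p, q)) :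
  exists2 K : R, 0 <= K & forall (t : R) (s : 'cV[R]_q), `|t| <= 1 ->
    `|map_mx (horner_eval t) P *m s| <= K * `|s|.
Proof.
have /choice[k kP] : forall i : 'I_p * 'I_q, exists K : R,
    forall t, `|t| <= 1 -> `|(P i.1 i.2).[t]| <= K.
  move=> i; have ch := @continuous_horner _ (P i.1 i.2).
  by have [_ /(_ 1)] := locbdd_meas_continuous ch.
exists (q%:R * \sum_i `|k i|); first by rewrite mulr_ge0// sumr_ge0.
move=> t s t1; apply: le_trans (mulmx_norm_le _ _) _.
rewrite ler_wpM2r// ler_wpM2l// [leLHS]/Num.norm/= mx_normrE.
apply/bigmax_leP; split=> [|i _]; first exact: sumr_ge0.
rewrite mxE (bigD1 i)//=; apply: le_trans (kP i t t1) _.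
apply: le_trans (ler_norm _) _; rewrite lerDl; exact: sumr_ge0.
Qed.

Lemma polynomial_trajectory_derivE n m (A : 'M[R]_n) (B : 'M[R]_(n, m)) p
    (Z : 'M[{poly R}]_(n, p)) (W : 'M[{poly R}]_(m, p)) (s : 'cV[R]_p) t :
  polynomial_trajectory A B Z W ->
  A *m (map_mx (horner_eval t) Z *m s) + B *m (map_mx (horner_eval t) W *m s) =
  map_mx (horner_eval t) (map_mx (deriv (R:=R)) Z) *m s.
Proof.
move=> [-> _].
have E k l (M : 'M[R]_(k, l)) : map_mx (horner_eval t) (map_mx polyC M) = M.
  by apply/matrixP => a b; rewrite !mxE /horner_eval hornerC.
by rewrite map_mxD !map_mxM/= mulmxDl -!mulmxA !E.
Qed.

Lemma polynomial_trajectory_primitive n m (A : 'M[R]_n) (B : 'M[R]_(n, m)) p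
    (Z : 'M[{poly R}]_(n, p)) (W : 'M[{poly R}]_(m, p)) (s : 'cV[R]_p) :
  polynomial_trajectory A B Z W ->
  cV_primitive (fun t => A *m (map_mx (horner_eval t) Z *m s) +
                         B *m (map_mx (horner_eval t) W *m s))
    (fun t => map_mx (horner_eval t) Z *m s).
Proof.
move=> ZW i.
have -> : (fun t => (map_mx (horner_eval t) Z *m s) i 0) =
    horner (\sum_j s j 0 *: Z i j).
  by apply/funext => t; rewrite poly_mx_curveE.
have -> : (fun t => (A *m (map_mx (horner_eval t) Z *m s) +
    B *m (map_mx (horner_eval t) W *m s)) i 0) =
    horner (\sum_j s j 0 *: Z i j)^`().
  apply/funext => t; rewrite (polynomial_trajectory_derivE _ _ ZW).
  rewrite poly_mx_curveE raddf_sum/=; congr horner.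
  by apply: eq_bigr => j _; rewrite derivZ mxE.
apply: primitive_C1; exact: continuous_horner.
Qed.

Lemma poly_mx_curve_continuous p q (P : 'M[{poly R}]_(p, q)) (s : 'cV[R]_q) :
  continuous (fun t : R => map_mx (horner_eval t) P *m s).
Proof.
apply: cV_continuousP => i.
have -> : (fun t => (map_mx (horner_eval t) P *m s) i 0) =
    horner (\sum_j s j 0 *: P i j).
  by apply/funext => t; rewrite poly_mx_curveE.
exact: continuous_horner.
Qed.

(** The polynomial controls are frozen outside [-1, 1], which keeps them
    bounded on the whole line. *)
Definition clamp (t : R) : R := Num.max (- 1) (Num.min 1 t).

Lemma clamp_norm t : `|clamp t| <= 1.
Proof.
rewrite ler_norml /clamp le_max lexx/= ge_max ge_min lexx/= andbT.
by lra.
Qed.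

Lemma clamp_id t : `|t| <= 1 -> clamp t = t.
Proof. by rewrite ler_norml /clamp => /andP[h1 h2]; rewrite min_r// max_r. Qed.

Lemma measurable_clamp : measurable_fun [set: R] clamp.
Proof.
apply: measurable_maxr; first exact: measurable_cst.
by apply: measurable_minr => //; exact: measurable_cst.
Qed.

End PolynomialCurves.

Section LocalControllability.
Context {R : realType} {n m : nat}.
Implicit Types (S : affine_system R n m).

(** What the vector field at (v + w, x + z) has beyond its affine part in
    (w, z) is [bilinear_part S w *m z]: see [vfield_expand]. *)
Definition bilinear_part S (w : 'cV[R]_m) : 'M[R]_n := \sum_i w i 0 *: sysB S i.

Lemma bilinear_partB S w w' :
  bilinear_part S (w - w') = bilinear_part S w - bilinear_part S w'.
Proof.
rewrite /bilinear_part -sumrB; apply: eq_bigr => i _.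
by rewrite cV_subE scalerBl.
Qed.

Lemma bilinear_part_bound S : exists2 K : R, 0 <= K &
  forall w (z : 'cV[R]_n), `|bilinear_part S w *m z| <= K * `|w| * `|z|.
Proof.
exists (n%:R * \sum_i `|sysB S i|); first by rewrite mulr_ge0// sumr_ge0.
move=> w z; apply: le_trans (mulmx_norm_le _ _) _.
rewrite ler_wpM2r// -mulrA ler_wpM2l// mulr_suml.
apply: le_trans (ler_norm_sum _ _ _) _; apply: ler_sum => i _.
by rewrite normrZ mulrC ler_wpM2l// cV_norm_ge.
Qed.

Lemma vfield_expand S v w x z : vfield S (v + w) (x + z) =
  vfield S v x + (Amx S v *m z + Bprime S x *m w) + bilinear_part S w *m z.
Proof.
have -> : Bprime S x *m w = sysC S *m w + bilinear_part S w *m x.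
  rewrite /Bprime mulmxDl; congr (_ + _).
  apply/matrixP => i j; rewrite ord1 /bilinear_part mulmx_suml summxE mxE.
  by apply: eq_bigr => k _; rewrite -scalemxAl mxE [RHS]mxE mulrC.
have AE : Amx S (v + w) = Amx S v + bilinear_part S w.
  rewrite /Amx /bilinear_part -addrA -big_split/=; congr (_ + _).
  by apply: eq_bigr => i _; rewrite mxE scalerDl.
rewrite /vfield AE !mulmxDl !mulmxDr.
move: (Amx S v *m x) (Amx S v *m z)
  (bilinear_part S w *m x) (bilinear_part S w *m z)
  (sysC S *m v) (sysC S *m w) (sysd S) => a1 a2 a3 a4 a5 a6 a7.
by apply/matrixP => i j; rewrite !mxE; ring.
Qed.

(** For a parameter [s] the control is [v] plus the polynomial that steers the
    linearization from 0 to [s] in time 1.  Since the system differs from its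
    linearization by a bilinear term, the displacement [F s] at time 1
    satisfies [perturbed_identity_onto] on a small ball. *)
Lemma local_controllability S (v : 'cV[R]_m) (x0 : 'cV[R]_n) :
  interior (sysOmega S) v ->
  equilibrium S v x0 -> \rank (kalman S v x0) = n ->
  nbhs x0 (orbit_pos S x0).
Proof.
move=> /nbhs_ballP[r /= r0 rO] eqx rk.
have [Z [W [ZW Z1]]] := polynomial_steering rk.
pose Zc t := map_mx (horner_eval t) Z; pose Wc t := map_mx (horner_eval t) W.
set A := Amx S v in ZW; set B := Bprime S x0 in ZW.
have [be be0 beP] := poly_mx_bound W; have [ga ga0 gaP] := poly_mx_bound Z.
have [ka ka0 kaP] := bilinear_part_bound S.
have a0 : 0 <= n%:R * `|A| by rewrite mulr_ge0.
have aP z : `|A *m z| <= n%:R * `|A| * `|z| := mulmx_norm_le A z.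
set a := n%:R * `|A| in a0 aP.
have b0 : 0 <= m%:R * `|B| by rewrite mulr_ge0.
have bP z : `|B *m z| <= m%:R * `|B| * `|z| := mulmx_norm_le B z.
set b := m%:R * `|B| in b0 bP.
(* A Lipschitz constant for the system along all the controls used below, since
   their deviation from [v] is at most [be] when [`|s| <= 1]. *)
pose K := a + ka * be + 1.
have kb0 : 0 <= ka * be by rewrite mulr_ge0.
have K0 : 0 < K by rewrite /K; lra.
pose E := expR (2 * K * `|1|).
have E0 : 0 < E by exact: expR_gt0.
pose c1 := b * be / K * E.
have c10 : 0 <= c1.
  by rewrite mulr_ge0 ?(ltW E0)// divr_ge0 ?(ltW K0)// mulr_ge0.
pose c3 := ka * be * (ga + c1) / K * E.
have c30 : 0 <= c3.
  by rewrite mulr_ge0 ?(ltW E0)// divr_ge0 ?(ltW K0)// mulr_ge0// addr_ge0.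
(* The second bound keeps the controls in [sysOmega S]; the third one makes the
   error of the linearization [1/2]-Lipschitz. *)
pose rho := Num.min 1 (Num.min (r / (2 * (be + 1))) (1 / (2 * (c3 + 1)))).
have rho0 : 0 < rho.
  by rewrite /rho !lt_min ltr01/= !divr_gt0//; lra.
have rho1 : rho <= 1 by rewrite /rho ge_min lexx.
have rhor : be * rho < r.
  apply: (@le_lt_trans _ _ (be * (r / (2 * (be + 1))))).
    by rewrite ler_wpM2l// /rho !ge_min lexx !orbT.
  rewrite mulrA ltr_pdivrMr; last lra.
  nra.
have rhoc : c3 * rho <= 2^-1.
  apply: (@le_trans _ _ (c3 * (1 / (2 * (c3 + 1))))).
    by rewrite ler_wpM2l// /rho !ge_min lexx !orbT.
  rewrite mulrA mulr1 ler_pdivrMr; last lra.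
  by lra.
pose w (s : 'cV[R]_n) (t : R) : 'cV[R]_m := Wc (clamp t) *m s.
pose u (s : 'cV[R]_n) (t : R) : 'cV[R]_m := v + w s t.
have wB s t : `|w s t| <= be * `|s| by exact: beP (clamp_norm t).
have bu s : `|s| <= rho -> bounded_control S (u s).
  move=> sr; split.
  - move=> k; have -> : (fun t => u s t k 0) =
        (fun t => v k 0 + horner (\sum_j s j 0 *: W k j) (clamp t)).
      by apply/funext => t; rewrite /u mxE /w poly_mx_curveE.
    apply: measurable_funD; first exact: measurable_cst.
    apply: measurableT_comp measurable_clamp.
    by apply: continuous_measurable_fun; exact: continuous_horner.
  - exists (`|v| + be * `|s|) => t; apply: le_trans (ler_normD _ _) _.
    by rewrite lerD2l.
  - apply: nearW => t; apply: rO; rewrite -ball_normE/= /u opprD addNKr normrN.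
    apply: le_lt_trans (wB s t) _; apply: le_lt_trans rhor.
    by rewrite ler_wpM2l.
have /choice[phi phiP] : forall s, exists phi, `|s| <= rho ->
    ode_solution (fun t => vfield S (u s t)) phi /\ phi 0 = x0.
  move=> s; have [sr|_] := boolP (`|s| <= rho); last by exists (fun=> x0).
  have [L SL] := vfield_caratheodory (bu s sr).
  have [phi sphi phi0] := picard_lindelof x0 SL.
  by exists phi.
pose z s t := phi s t - x0.
have phiE s t : phi s t = x0 + z s t by rewrite /z addrC subrK.
have lphi s : `|s| <= rho ->
    cV_locbdd_meas (fun t => vfield S (u s t) (phi s t)).
  move=> sr; have [[cphi _] _] := phiP s sr.
  exact: vfield_locbdd (bu s sr) cphi.
(* The deviation from the equilibrium is at most linear in [s]. *)
have zB s t : `|s| <= rho -> `|t| <= 1 -> `|z s t| <= c1 * `|s|.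
  move=> sr t1; have [[cphi pphi] phi0] := phiP s sr.
  have lx : cV_locbdd_meas (fun _ : R => vfield S v x0).
    by move=> i; exact: locbdd_meas_cst.
  have px := (equilibrium_ode_solution eqx).2.
  have H := gronwall K0 _ (cV_locbdd_measB (lphi s sr) lx)
    (cV_primitiveB (lphi s sr) lx pphi px) _ t1.
  have cs0 : 0 <= b * be * `|s| by rewrite !mulr_ge0.
  have := H _ cs0; rewrite phi0 subrr normr0 mulr0 add0r -/(z s t) => H1.
  apply: le_trans (H1 _) _.
    move=> t' _; rewrite -/(z s t') phiE /u vfield_expand eqx add0r subr0.
    apply: le_trans (ler_normD _ _) _.
    apply: le_trans (lerD (ler_normD _ _) (lexx _)) _.
    have h1 := aP (z s t').
    have h2 := le_trans (bP (w s t')) (ler_wpM2l b0 (wB s t')).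
    have h3 : `|bilinear_part S (w s t') *m z s t'| <= ka * be * `|z s t'|.
      apply: le_trans (kaP _ _) _; rewrite ler_wpM2r// ler_wpM2l//.
      apply: le_trans (wB s t') _; rewrite -[leRHS]mulr1 ler_wpM2l//.
      exact: le_trans sr rho1.
    have z0 := normr_ge0 (z s t').
    rewrite /K !mulrDl mul1r; move: h1 h2 h3; rewrite -/A -/B !mulrA; lra.
  rewrite /c1; have -> : b * be * `|s| / K * expR (2 * K * `|t|) =
      b * be / K * `|s| * expR (2 * K * `|t|) by ring.
  have -> : b * be / K * E * `|s| = b * be / K * `|s| * E by ring.
  rewrite ler_wpM2l//.
    by rewrite mulr_ge0// divr_ge0 ?(ltW K0)// mulr_ge0.
  by rewrite /E ler_expR ler_wpM2l ?normr1//; lra.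
pose F s := phi s 1 - x0.
have F0 : F 0 = 0.
  have := zB 0 1; rewrite !normr0 !normr1 mulr0 lexx => /(_ (ltW rho0) isT).
  by rewrite normr_le0 => /eqP.
have Flip s s' : `|s| <= rho -> `|s'| <= rho ->
    `|F s - F s' - (s - s')| <= 2^-1 * `|s - s'|.
  move=> sr sr'; pose q := s - s'.
  have [[cphi pphi] phi0] := phiP s sr.
  have [[cphi' pphi'] phi0'] := phiP s' sr'.
  (* Compare the difference of the two trajectories with the linear trajectory
     that ends at [q]. *)
  pose lin t := A *m (Zc t *m q) + B *m (Wc t *m q).
  have pZ : cV_primitive lin (fun t => Zc t *m q).
    exact: polynomial_trajectory_primitive ZW.
  have lZ : cV_locbdd_meas lin.
    move=> i; apply: locbdd_meas_continuous; apply: cV_coord_continuous.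
    rewrite (_ : lin = fun t =>
      map_mx (horner_eval t) (map_mx (deriv (R:=R)) Z) *m q).
      exact: poly_mx_curve_continuous.
    by apply/funext => t; exact: polynomial_trajectory_derivE ZW.
  have H := gronwall K0 _
    (cV_locbdd_measB (cV_locbdd_measB (lphi s sr) (lphi s' sr')) lZ)
    (cV_primitiveB (cV_locbdd_measB (lphi s sr) (lphi s' sr')) lZ
      (cV_primitiveB (lphi s sr) (lphi s' sr') pphi pphi') pZ) _ (lexx `|1|).
  pose c := ka * be * (ga + c1) * rho * `|q|.
  have c0 : 0 <= c.
    by rewrite !mulr_ge0 ?(ltW rho0)// addr_ge0.
  have := H c c0.
  have Z0q : Zc 0 *m q = 0 by rewrite /Zc ZW.2 mul0mx.
  have Z1q : Zc 1 *m q = q by rewrite /Zc Z1 mul1mx.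
  rewrite phi0 phi0' Z0q Z1q subrr subr0 normr0 mulr0 add0r -/E.
  move=> H1; have -> : F s - F s' - (s - s') = phi s 1 - phi s' 1 - q.
    by rewrite /F /q; apply/matrixP => i j; rewrite !mxE; ring.
  apply: le_trans (H1 _) _; last first.
    have -> : c / K * E = c3 * rho * `|q| by rewrite /c /c3; ring.
    by rewrite ler_wpM2r.
  move=> t; rewrite normr1 => t1.
  pose zeta := Zc t *m q; pose e := z s t - z s' t - zeta.
  have -> : phi s t - phi s' t - Zc t *m q = e.
    by rewrite /e /z; apply/matrixP => i j; rewrite !mxE; ring.
  have wq : w q t = w s t - w s' t by rewrite /w /q mulmxBr.
  have linE : lin t = A *m zeta + (B *m w s t - B *m w s' t).
    by rewrite /lin -mulmxBr -wq /w clamp_id.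
  (* Besides the terms in the error [e] itself only two remain, both of second
     order: each is bilinear in [q] and a quantity of size [rho]. *)
  have -> : vfield S (u s t) (phi s t) - vfield S (u s' t) (phi s' t) - lin t =
      A *m e + bilinear_part S (w s t) *m e + bilinear_part S (w s t) *m zeta +
      bilinear_part S (w q t) *m z s' t.
    rewrite !phiE /u !vfield_expand eqx !add0r linE wq bilinear_partB /e.
    rewrite !mulmxBr !mulmxBl -/A -/B.
    move: (A *m z s t) (A *m z s' t) (A *m zeta) (B *m w s t) (B *m w s' t)
      (bilinear_part S (w s t) *m z s t) (bilinear_part S (w s t) *m z s' t)
      (bilinear_part S (w s t) *m zeta) (bilinear_part S (w s' t) *m z s' t)
      => a1 a2 a3 a4 a5 a6 a7 a8 a9.
    by apply/matrixP => i j; rewrite !mxE; ring.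
  have h1 := aP e.
  have ws1 : `|w s t| <= be * rho.
    by apply: le_trans (wB s t) _; rewrite ler_wpM2l.
  have h2 : `|bilinear_part S (w s t) *m e| <= ka * be * `|e|.
    apply: le_trans (kaP _ _) _; rewrite ler_wpM2r// ler_wpM2l//.
    by apply: le_trans ws1 _; rewrite -[leRHS]mulr1 ler_wpM2l.
  have h3 : `|bilinear_part S (w s t) *m zeta| <= ka * (be * rho) * (ga * `|q|).
    apply: le_trans (kaP _ _) _; apply: ler_pM => //.
    - by rewrite mulr_ge0.
    - by rewrite ler_wpM2l.
    - exact: gaP.
  have h4 : `|bilinear_part S (w q t) *m z s' t| <=
      ka * (be * `|q|) * (c1 * rho).
    apply: le_trans (kaP _ _) _; apply: ler_pM => //.
    - by rewrite mulr_ge0.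
    - by rewrite ler_wpM2l.
    - by apply: le_trans (zB s' t sr' t1) _; rewrite ler_wpM2l.
  apply: le_trans (ler_normD _ _) _.
  apply: le_trans (lerD (ler_normD _ _) h4) _.
  apply: le_trans (lerD (lerD (ler_normD _ _) h3) (lexx _)) _.
  apply: le_trans (lerD (lerD (lerD h1 h2) (lexx _)) (lexx _)) _.
  have e0 := normr_ge0 e.
  rewrite /K /c; lra.
apply/nbhs_ballP; exists (rho / 2) => /=; first by rewrite divr_gt0.
move=> y; rewrite -ball_normE/= distrC => /ltW yr.
have [s sr Fs] := perturbed_identity_onto F0 Flip yr.
have [sphi phi0] := phiP s sr.
apply/orbit_posP; exists 1, (u s), (phi s); split=> //; first exact: bu.
by move: Fs; rewrite /F => /(canRL (subrK _)); rewrite subrK.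
Qed.

End LocalControllability.

(** * The control set of a path of equilibria *)

Section KalmanReversal.
Context {R : realType} {n m : nat}.
Implicit Types (S : affine_system R n m).

(** Reversal only changes the signs of the blocks of the Kalman matrix, and a
    right inverse absorbs the signs. *)
Lemma kalman_reverse_rank S v x :
  \rank (kalman S v x) = n -> \rank (kalman (reverse_system S) v x) = n.
Proof.
move=> rk; apply/eqP; rewrite -/(row_free _).
have /row_freeP[K KP] : row_free (kalman S v x) by rewrite /row_free rk.
apply/row_freeP; exists (\mxcol_k ((-1) ^+ k.+1 *: submxcol K k)).
rewrite mul_mxrow_mxcol -KP -[in RHS](submxcolK K) mul_mxrow_mxcol.
apply: eq_bigr => k _.
have BE : Bprime (reverse_system S) x = - Bprime S x.
  rewrite /Bprime/= opprD; congr (_ + _); apply/matrixP => i j.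
  by rewrite mxE mulNmx [LHS]mxE [RHS]mxE [in RHS]mxE.
have AE l : Amx (reverse_system S) v ^+ l = (-1) ^+ l *: Amx S v ^+ l.
  elim: l => [|l ih]; first by rewrite !expr0 scale1r.
  by rewrite !exprS ih Amx_reverse -!mulmxE mulNmx -scalemxAr mulN1r scaleNr.
rewrite AE BE mulmxN -scalemxAl mulNmx -scalemxAl -scalemxAr scalerA.
by rewrite exprSr mulrA -expr2 sqrr_sign mul1r scaleN1r opprK.
Qed.

Lemma local_reverse_controllability S (v : 'cV[R]_m) (x : 'cV[R]_n) :
  interior (sysOmega S) v -> equilibrium S v x ->
  \rank (kalman S v x) = n -> nbhs x (orbit_neg S x).
Proof.
move=> Ov eqx rk; rewrite orbit_neg_reverse.
apply: (@local_controllability _ _ _ (reverse_system S) v) => //.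
  by rewrite /equilibrium vfield_reverse eqx oppr0.
exact: kalman_reverse_rank.
Qed.

End KalmanReversal.

Theorem theorem5p6 (R : realType) (n m : nat) (S : affine_system R n m)
    (Ceq : set 'cV[R]_n) :
  Ceq `<=` E0 S ->
  pathwise_connected R Ceq ->
  (forall (v : 'cV[R]_m) (x : 'cV[R]_n),
     interior (sysOmega S) v -> Ceq x -> equilibrium S v x ->
     \rank (kalman S v x) = n) ->
  exists D : set 'cV[R]_n,
    [/\ control_set S D,
        Ceq `<=` interior D &
        forall x, Ceq x -> D = orbit_neg S x `&` closure (orbit_pos S x)].
Proof.
move=> CE0 pC rk.
have loc x : Ceq x -> nbhs x (mutually_reachable S x).
  move=> Cx; have [v Ov vx] := CE0 x Cx.
  apply: filterI; first exact: local_controllability (rk _ _ Ov Cx vx).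
  exact: local_reverse_controllability (rk _ _ Ov Cx vx).
have [[x Cx] _] := pC; have [v Ov vx] := CE0 x Cx.
have Deq y : Ceq y -> control_set_of S x = control_set_of S y.
  move=> Cy; have xy := mutually_reachable_pathwise_connected pC loc Cx Cy.
  apply/seteqP; split; apply: control_set_of_mutually_reachable => //.
  exact: mutually_reachable_sym.
exists (control_set_of S x); split=> //.
- exact: control_set_of_control_set (interior_subset Ov) vx (loc _ Cx).
- move=> y Cy; rewrite (Deq y Cy); apply: filterS (loc y Cy) => z [yz zy].
  by split=> //; exact: subset_closure.
Qed.
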